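(* Let $E=F\oplus iF$ be a universally complete complex vector lattice, let $c\in E$ and $a_n\in E$ $(n\ge 0)$, and consider the power series $\sum_{n=0}^\infty a_n(z-c)^n$ on $E$ with radius of convergence $\rho\in F^s$. Let $L:=\limsup_{n\to\infty}|a_n|^{1/n}$, which exists in the sup-completion $F^s$ of $F$. Then the following identities hold. (i) $B_L^d=B_{\rho_\infty}$. (ii) $B_{L_\infty}=B_{\rho}^d$. (iii) $(L_{\mathcal F})^\ast=\rho_{\mathcal F}$. In particular, $L^{-1}=\rho$, where $L^{-1}$ denotes the generalized inverse of $L$ in $F^s$.
   Context: Universally complete complex vector lattices: $E=F\oplus iF$, where $F$ is a universally complete real vector lattice (Dedekind complete, and every nonempty set of pairwise disjoint positive elements has a supremum). The modulus is $|x+iy|:=\sup\{(\cos\theta)x+(\sin\theta)y:\theta\in[0,2\pi]\}$, and $E_+:=\{z\in E:|z|=z\}=F_+$. $F$ is an $f$-algebra with multiplicative identity $e$; its multiplication is extended complex bilinearly to $E$; $z^0:=e$. Every $x\in E_+$ has a unique $n$-th root $x^{1/n}\in E_+$. Every band of $E$ or $F$ is itself universally complete; for $z\in E$, $z^\ast$ denotes the multiplicative inverse of $z$ in the band $B_z$ generated by $z$ (the identity of $B_z$ being the band projection of $e$ onto $B_z$). Order convergence of sequences: $z_n\to z$ in $E$ if there is a sequence $q_m\downarrow 0$ in $E_+$ such that for every $m$ there is $N$ with $|z_n-z|\le q_m$ for all $n\ge N$. A series converges in order if its partial sums do. Power series: $\bar\Delta(c,r):=\{z\in E:|z-c|\le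 r\}$ for $r\in E_+$. A power series $\sum_{n=0}^\infty a_n(z-c)^n$ converges uniformly in order on $D\subseteq E$ if there is a sequence $p_m\downarrow0$ such that for every $m\ge0$ there is $K\ge 0$ with $\sup_{z\in D}\bigl|\sum_{n=0}^k a_n(z-c)^n-\sum_{n=0}^\infty a_n(z-c)^n\bigr|\le p_m$ for all $k\ge K$. The spectrum of convergence is $\Omega:=\{r\in E_+:\sum_{n=0}^\infty a_n(z-c)^n\text{ converges uniformly in order on }\bar\Delta(c,r)\}$, and the radius of convergence is $\rho:=\sup\Omega$, taken in $F^s$. Sup-completion: $F^s$ is the (essentially unique) ordered cone (commutative monoid with compatible multiplication by scalars in $[0,\infty)$ and compatible partial order), which is a lattice, such that: every nonempty subset bounded above (below) has a supremum (infimum); $F$ is the set of additively invertible elements of $F^s$, with coinciding algebraic and order structures; $y=\sup\{x\in F:x\le y\}$ for all $y\in F^s$; $z+(x\wedge y)=(z+x)\wedge(z+y)$ for $x\in F$, $y,z\in F^s$; any $y\in F^s$ with $y\le x$ for some $x\in F$ lies in $F$; $F^s$ has a largest element; and if $\sup A=\sup B$ for nonempty $A,B\subseteq F^s$ then $\sup_{a\in A}(a\wedge x)=\sup_{b\in B}(b\wedge x)$ for all $x\in F$. Thus every nonempty subset of $F^s$ has a supremum. For $x_n\in F_+$, $\limsup_{n\to\infty}x_n:=\inf_n\sup_{m\ge n}x_m$ in $F^s$. For a band $B$ of $F$, its sup-completion $B^s$ is viewed inside $F^s$ as the set of suprema of nonempty subsets of $B$. For $0\le u\in F^s$: $\mathbb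 P_u$ is the band projection on $F$ given by $\mathbb P_u(x):=\sup_{n\ge1}(x\wedge nu)$ for $x\in F_+$ and $\mathbb P_u(x):=\mathbb P_u(x^+)-\mathbb P_u(x^-)$ for $x\in F$; $B_u$ is the range of $\mathbb P_u$ (equivalently the band generated by $\mathbb P_u(e)$), and $B_u^d$ is its disjoint complement in $F$. Moreover $u_\infty:=\inf_{n\ge1}n^{-1}u\in F^s$ and $u_{\mathcal F}:=\sup\{x-x\wedge u_\infty: x\in F_+,\ x\le u\}$; one has $u_{\mathcal F}\in F_+$. The generalized inverse of $0\le u\in F^s$ is $u^{-1}:=(u_{\mathcal F})^\ast+\infty_u^d$, where $\infty_u^d$ is the largest element of $(B_u^d)^s$. *)

(* Defs.v *)
From HB Require Import structures.
From mathcomp Require Import all_boot all_order all_algebra.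
From mathcomp Require Import all_classical all_reals all_analysis.
From mathcomp Require Import ring.

Set Implicit Arguments.
Unset Strict Implicit.
Unset Printing Implicit Defensive.

Import Order.TTheory GRing.Theory Num.Theory.

Local Open Scope classical_set_scope.
Local Open Scope ring_scope.

(* The lattice and ring operations are fields of mixins over [porderZmodType]
   (the library's structures combining them with a partially ordered Zmodule
   start at [numDomainType]); the library instances are derived below. *)
HB.mixin Record isVectorLattice (R : realType) F
    of GRing.Lmodule R F & Num.POrderedZmodule F := {
  vmeet : F -> F -> F ;
  vjoin : F -> F -> F ;
  le_vmeet : forall x y z : F, (x <= vmeet y z) = (x <= y) && (x <= z) ;
  vjoin_le : forall x y z : F, (vjoin x y <= z) = (x <= z) && (y <= z) ;
  vlat_leD : forall x y z : F, x <= y -> x + z <= y + z ;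
  vlat_scale_ge0 : forall (a : R) (x : F), 0 <= a -> 0 <= x -> 0 <= a *: x
}.

#[short(type="vectorLatticeType")]
HB.structure Definition VectorLattice (R : realType) :=
  { F of GRing.Lmodule R F & Num.POrderedZmodule F & isVectorLattice R F }.

HB.mixin Record isUniversallyComplete (R : realType) F of VectorLattice R F := {
  dedekind_complete : forall A : set F,
    A !=set0 -> has_ubound A -> supremums A !=set0 ;
  laterally_complete : forall A : set F,
    A !=set0 -> (forall x, A x -> 0 <= x) ->
    (forall x y, A x -> A y -> x <> y -> vmeet x y = 0) ->
    supremums A !=set0
}.

(* Commutativity is automatic for an Archimedean f-algebra.  The identity may
   be [0], so that the zero lattice is not excluded. *)
HB.mixin Record isFAlgebra (R : realType) F of VectorLattice R F := {
  fone : F ;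
  fmul : F -> F -> F ;
  fmulA : associative fmul ;
  fmulC : commutative fmul ;
  fmul1 : left_id fone fmul ;
  fmulDl : left_distributive fmul +%R ;
  fmul_scaleAl : forall (a : R) (x y : F), a *: fmul x y = fmul (a *: x) y ;
  fmul_ge0 : forall x y : F, 0 <= x -> 0 <= y -> 0 <= fmul x y ;
  fmul_disj : forall x y z : F,
    vmeet x y = 0 -> 0 <= z -> vmeet (fmul z x) y = 0
}.

#[short(type="univCompleteType")]
HB.structure Definition UnivComplete (R : realType) :=
  { F of VectorLattice R F & isUniversallyComplete R F & isFAlgebra R F }.

HB.instance Definition _ (R : realType) (F : univCompleteType R) :=
  Order.POrder_isMeetSemilattice.Build ring_display F le_vmeet.
HB.instance Definition _ (R : realType) (F : univCompleteType R) :=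
  Order.POrder_isJoinSemilattice.Build ring_display F vjoin_le.
HB.instance Definition _ (R : realType) (F : univCompleteType R) :=
  GRing.Zmodule_isComPzRing.Build F fmulA fmulC fmul1 fmulDl.

(* Only the values of [cscale] at nonnegative scalars are meaningful. *)
HB.mixin Record isOrderedCone (R : realType) C
    of Order.Lattice ring_display C := {
  czero : C ;
  cplus : C -> C -> C ;
  cplusA : associative cplus ;
  cplusC : commutative cplus ;
  cplus0 : left_id czero cplus ;
  cscale : R -> C -> C ;
  cscale0 : forall x, cscale 0 x = czero ;
  cscale1 : forall x, cscale 1 x = x ;
  cscaleA : forall a b x, 0 <= a -> 0 <= b ->
    cscale a (cscale b x) = cscale (a * b) x ;
  cscaleDl : forall a b x, 0 <= a -> 0 <= b ->
    cscale (a + b) x = cplus (cscale a x) (cscale b x) ;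
  cscaleDr : forall a x y, 0 <= a ->
    cscale a (cplus x y) = cplus (cscale a x) (cscale a y) ;
  cone_leD : forall x y z : C, x <= y -> cplus x z <= cplus y z ;
  cone_leZ : forall a (x y : C), 0 <= a -> x <= y -> cscale a x <= cscale a y
}.

#[short(type="orderedConeType")]
HB.structure Definition OrderedCone (R : realType) :=
  { C of Order.Lattice ring_display C & isOrderedCone R C }.

HB.instance Definition _ (R : realType) (C : orderedConeType R) :=
  GRing.isNmodule.Build C cplusA cplusC cplus0.

Record is_sup_completion (R : realType) (F : univCompleteType R)
    (Fs : orderedConeType R) (iota : F -> Fs) : Prop := {
  sc_le : {mono iota : x y / x <= y} ;
  sc_0 : iota 0 = 0 ;
  sc_D : {morph iota : x y / x + y} ;
  sc_Z : forall (a : R) x, 0 <= a -> iota (a *: x) = cscale a (iota x) ;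
  sc_invertible : forall y : Fs, range iota y <-> exists y' : Fs, y + y' = 0 ;
  sc_sup : forall A : set Fs, A !=set0 -> has_ubound A -> supremums A !=set0 ;
  sc_inf : forall A : set Fs, A !=set0 -> has_lbound A -> infimums A !=set0 ;
  sc_dense : forall y : Fs, supremums (iota @` [set x | iota x <= y]) y ;
  sc_addI : forall (x : F) (y z : Fs),
    z + Order.meet (iota x) y = Order.meet (z + iota x) (z + y) ;
  sc_solid : forall (y : Fs) (x : F), y <= iota x -> range iota y ;
  sc_top : exists t : Fs, forall y, y <= t ;
  sc_supI : forall (A B : set Fs) (s : Fs),
    A !=set0 -> B !=set0 -> supremums A s -> supremums B s -> forall x : F,
    supremum (0 : Fs) [set Order.meet a (iota x) | a in A] =
    supremum (0 : Fs) [set Order.meet b (iota x) | b in B]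
}.

(** ** The complexification [F (+) iF] *)

Record cplx (T : Type) := Cplx { cre : T ; cim : T }.

Section ComplexRing.
Variable F : comPzRingType.
Implicit Types z w v : cplx F.

Definition cplx_pair z := (cre z, cim z).
Definition pair_cplx (p : F * F) := Cplx p.1 p.2.
Lemma cplx_pairK : cancel cplx_pair pair_cplx. Proof. by case. Qed.
HB.instance Definition _ := Choice.copy (cplx F) (can_type cplx_pairK).

Definition cadd z w := Cplx (cre z + cre w) (cim z + cim w).
Definition copp z := Cplx (- cre z) (- cim z).
Definition cmul z w :=
  Cplx (cre z * cre w - cim z * cim w) (cre z * cim w + cim z * cre w).

Lemma caddA : associative cadd.
Proof. by move=> [a b] [c d] [x y]; rewrite /cadd /= !addrA. Qed.
Lemma caddC : commutative cadd.
Proof. by move=> [a b] [c d]; rewrite /cadd /= addrC (addrC b). Qed.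
Lemma cadd0 : left_id (Cplx 0 0) cadd.
Proof. by move=> [a b]; rewrite /cadd /= !add0r. Qed.
Lemma caddN : left_inverse (Cplx 0 0) copp cadd.
Proof. by move=> [a b]; rewrite /cadd /copp /= !addNr. Qed.
HB.instance Definition _ :=
  GRing.isZmodule.Build (cplx F) caddA caddC cadd0 caddN.

Lemma cmulA : associative cmul.
Proof.
by move=> [a b] [c d] [x y]; congr Cplx => /=; ring.
Qed.
Lemma cmulC : commutative cmul.
Proof.
by move=> [a b] [c d]; congr Cplx => /=; ring.
Qed.
Lemma cmul1 : left_id (Cplx 1 0) cmul.
Proof. by move=> [a b]; rewrite /cmul /= !mul1r !mul0r subr0 addr0. Qed.
Lemma cmulDl : left_distributive cmul +%R.
Proof.
by move=> [a b] [c d] [x y]; congr Cplx => /=; ring.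
Qed.
HB.instance Definition _ :=
  GRing.Zmodule_isComPzRing.Build (cplx F) cmulA cmulC cmul1 cmulDl.

End ComplexRing.

Section Definitions.
Variables (R : realType) (F : univCompleteType R).
Local Notation E := (cplx F).

(* The modulus lies in [E_+ = F_+], so it is given as an element of [F]. *)
Definition modulus (z : E) : F :=
  supremum 0 [set cos t *: cre z + sin t *: cim z | t in `[0, 2 * pi : R]].

(** ** Order convergence and power series *)

Definition decreases_to0 (p : nat -> F) :=
  nonincreasing_seq p /\ infimums (range p) 0.

Definition order_cvg (z : nat -> E) (l : E) :=
  exists2 q, decreases_to0 q &
    forall m, exists N, forall n, (N <= n)%N -> modulus (z n - l) <= q m.

Definition power_psum (a : nat -> E) (c z : E) (k : nat) : E :=
  \sum_(0 <= n < k.+1) a n * (z - c) ^+ n.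

Definition unif_order_cvg (a : nat -> E) (c : E) (D : set E) :=
  exists2 S : E -> E,
    forall z, D z -> order_cvg (power_psum a c z) (S z) &
    exists2 p, decreases_to0 p &
      forall m, exists K, forall k, (K <= k)%N ->
        exists2 s, supremums [set modulus (power_psum a c z k - S z) | z in D] s
          & s <= p m.

Definition closed_disc (c : E) (r : F) : set E := [set z | modulus (z - c) <= r].

Definition cvg_spectrum (a : nat -> E) (c : E) : set F :=
  [set r | 0 <= r /\ unif_order_cvg a c (closed_disc c r)].

(** ** Bands and inverses in [F] *)

Definition vabs (x : F) : F := Order.join x (- x).

Definition vpos (x : F) : F := Order.join x 0.

Definition vneg (x : F) : F := Order.join (- x) 0.

Definition is_ideal (I : set F) :=
  [/\ I 0, forall x y, I x -> I y -> I (x + y),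
      forall (a : R) x, I x -> I (a *: x) &
      forall x y, vabs y <= vabs x -> I x -> I y].

Definition is_band (B : set F) :=
  is_ideal B /\ forall A s, A `<=` B -> supremums A s -> B s.

Definition band_gen (x : F) : set F := smallest is_band [set x].

Definition disj_compl (A : set F) : set F :=
  [set x | forall y, A y -> Order.meet (vabs x) (vabs y) = 0].

Definition band_proj (B : set F) (x : F) : F :=
  xget 0 [set y : F | B y /\ disj_compl B (x - y)].

(* [x^*]: the inverse of [x] in the band generated by [x]. *)
Definition band_inv (x : F) : F :=
  xget 0 [set y : F | band_gen x y /\ x * y = band_proj (band_gen x) 1].

Definition nth_root (n : nat) (x : F) : F :=
  xget 0 [set y : F | 0 <= y /\ y ^+ n = x].

(** ** Sup-completion *)

Variables (Fs : orderedConeType R) (iota : F -> Fs).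

Definition fin_part (y : Fs) : F := xget 0 [set x : F | iota x = y].

Definition limsup_s (x : nat -> F) : Fs :=
  infimum (0 : Fs) (range (fun n =>
    supremum (0 : Fs) [set iota (x m) | m in [set m | (n <= m)%N]])).

(* The index [0], where the root is meaningless, does not affect the limsup. *)
Definition root_limsup (a : nat -> E) : Fs :=
  limsup_s (fun n => nth_root n (modulus (a n))).

Definition cvg_radius (a : nat -> E) (c : E) : Fs :=
  supremum (0 : Fs) (iota @` cvg_spectrum a c).

Definition proj_pos (u : Fs) (x : F) : F :=
  fin_part (supremum (0 : Fs)
    [set Order.meet (iota x) (u *+ n) | n in [set n | (0 < n)%N]]).

Definition proj_s (u : Fs) (x : F) : F :=
  proj_pos u (vpos x) - proj_pos u (vneg x).

Definition band_s (u : Fs) : set F := range (proj_s u).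

Definition inf_part (u : Fs) : Fs :=
  infimum (0 : Fs) [set cscale (n%:R^-1 : R) u | n in [set n | (0 < n)%N]].

(* For [x] in [F], the meet of [iota x] with any element of [Fs] is in the
   range of [iota]. *)
Definition finite_part (u : Fs) : F :=
  fin_part (supremum (0 : Fs)
    [set iota (x - fin_part (Order.meet (iota x) (inf_part u)))
       | x in [set x | 0 <= x /\ iota x <= u]]).

(* The sup-completion of a band [B] of [F], viewed inside [Fs]. *)
Definition band_sup_completion (B : set F) : set Fs :=
  [set y | exists A : set F, [/\ A !=set0, A `<=` B & supremums (iota @` A) y]].

Definition infty_d (u : Fs) : Fs :=
  let B := band_sup_completion (disj_compl (band_s u)) in
  xget (0 : Fs) (B `&` ubound B).

Definition gen_inv (u : Fs) : Fs := iota (band_inv (finite_part u)) + infty_d u.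

End Definitions.

(* Main.v *)
Require Import Defs.
From HB Require Import structures.
From mathcomp Require Import all_boot all_order all_algebra.
From mathcomp Require Import all_classical all_reals all_analysis.
From mathcomp Require Import ring lra.

Set Implicit Arguments.
Unset Strict Implicit.
Unset Printing Implicit Defensive.

Import Order.TTheory GRing.Theory Num.Theory.

Local Open Scope classical_set_scope.
Local Open Scope ring_scope.

(** Cauchy-Hadamard, read locally. If [F] is pictured as a space of functions, an
    idempotent [q] of [F] is the indicator of a set, and [le_on q x y] says that
    [x <= y] on that set; a nonzero idempotent is called a cell. Three facts let one
    argue on cells as with real numbers. A failure of [x <= y] leaves a positive
    constant gap on some cell ([nle_gap], [le_on_or]). Every element of [F] is
    bounded, and even constant up to any [e > 0], on some smaller cell
    ([le_on_bounded], [le_on_approx]). For every real [r >= 0] a positive element of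
    the sup-completion is at least [r] on an idempotent and at most [r] on its
    complement ([s_level]).

    This already gives roots and a multiplicative modulus with
    [|z|^2 = re^2 + im^2] ([vroot_exists], [modulus_sup], [modulusM]).

    Let [L] be the upper limit of the roots and [rho] the radius. If [L <= r] on a
    cell and [r t < 1], choose [s > r] with [s t < 1]: on a smaller cell [p] all roots
    [|a_n|^(1/n)] from some index on are at most [s], so the series is dominated by a
    geometric one on the disc of radius [t p], whence [t p] is in the spectrum
    ([radius_super_reciprocal]). As [t p] vanishes off [p], the behaviour of the
    coefficients elsewhere does not matter, and [rho], being a supremum, collects all
    these pieces. Conversely, if [L >= r] and [rho >= t] on a cell with [r t > 1], then
    some member of the spectrum is close to [t] on a smaller cell, the terms of the
    series are bounded there, and yet infinitely many roots come close to [r] on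
    smaller cells, which makes the terms exceed any bound
    ([radius_sub_reciprocal]).

    These two relations say that [rho] is the pointwise reciprocal of [L], with
    [1 / 0 = +oo] and [1 / +oo = 0], and they imply the four conclusions for any two
    positive elements [u], [v] of the sup-completion ([reciprocal_gen_inv]). The bands
    in question consist of the [x] with [x p = x] for an idempotent [p]: the support
    [e_u] of [u], its complement, and the support [f_v] of the infinite part of [v];
    comparing on cells yields [f_v = 1 - e_u]. The product of the finite parts is
    computed on cells where both are nearly constant. The last identity follows from
    [u = u_F + u_oo] ([finite_inf_decomp]). That [u_F] lies in [F] is where lateral
    completeness enters ([lateral_bound]). *)

(** * Order and multiplication in the f-algebra *)

Section FAlgebra.
Context (R : realType) (F : univCompleteType R).
Implicit Types (x y z p q s : F) (r t : R) (n : nat).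

Definition rcst r : F := r *: (1 : F).

Lemma scale_rcst r x : r *: x = rcst r * x.
Proof.
have := @fmul_scaleAl R F r (1 : F) x.
rewrite (_ : fmul _ _ = 1 * x) // (_ : fmul _ _ = rcst r * x) //.
by rewrite mul1r.
Qed.

Lemma rcst_nmod_morphism : nmod_morphism rcst.
Proof. by split; [exact: scale0r | move=> r s; exact: scalerDl]. Qed.

Lemma rcst_monoid_morphism : monoid_morphism rcst.
Proof.
by split; [exact: scale1r | move=> r s; rewrite -scale_rcst /rcst scalerA].
Qed.

HB.instance Definition _ := GRing.isNmodMorphism.Build R F rcst rcst_nmod_morphism.
HB.instance Definition _ :=
  GRing.isMonoidMorphism.Build R F rcst rcst_monoid_morphism.

Lemma vsub_ge0 x y : (0 <= y - x) = (x <= y).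
Proof.
apply/idP/idP => h.
  by have := vlat_leD _ _ x h; rewrite subrK add0r.
by have := vlat_leD _ _ (- x) h; rewrite subrr.
Qed.

Lemma vaddr_ge0 x y : 0 <= x -> 0 <= y -> 0 <= x + y.
Proof.
by move=> x0 y0; apply: le_trans y0 _; have := vlat_leD _ _ y x0; rewrite add0r.
Qed.

Lemma vmulr_ge0 x y : 0 <= x -> 0 <= y -> 0 <= x * y.
Proof. exact: fmul_ge0. Qed.

(** Replaces linear arithmetic over [F]: exhibit [y - x] as a visibly positive
    expression. *)
Lemma vle_of_sub d x y : 0 <= d -> y - x = d -> x <= y.
Proof. by move=> d0 e; rewrite -vsub_ge0 e. Qed.

Lemma vge0_eq d x : 0 <= d -> x = d -> 0 <= x.
Proof. by move=> d0 ->. Qed.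

Lemma vle_of_le a b x y : a <= b -> y - x = b - a -> x <= y.
Proof. by rewrite -(vsub_ge0 a) => h e; rewrite -vsub_ge0 e. Qed.

Lemma vleD x y z u : x <= y -> z <= u -> x + z <= y + u.
Proof.
rewrite -(vsub_ge0 x) -(vsub_ge0 z) => h1 h2.
by apply: (vle_of_sub (vaddr_ge0 h1 h2)); ring.
Qed.

Lemma vler_wpM2l z x y : 0 <= z -> x <= y -> z * x <= z * y.
Proof.
move=> z0; rewrite -(vsub_ge0 x) => h.
by apply: (vle_of_sub (vmulr_ge0 z0 h)); ring.
Qed.

Lemma vle_subr x y z : x <= y - z -> x + z <= y.
Proof. by move=> h; apply: (vle_of_le h); ring. Qed.

Lemma vle_addr x y z : x + z <= y -> x <= y - z.
Proof. by move=> h; apply: (vle_of_le h); ring. Qed.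

(** ** Positive parts and disjointness *)

Lemma vposE x : x = vpos x - vneg x.
Proof.
rewrite /vpos /vneg; apply/eqP; rewrite eq_le; apply/andP; split.
- apply: vle_addr; rewrite addrC; apply: vle_subr; rewrite leUx.
  apply/andP; split; last by rewrite vsub_ge0 leUl.
  by rewrite -vsub_ge0; apply: (vge0_eq (d := Order.join x 0));
    [rewrite leUr|ring].
- rewrite -(opprK x) opprK.
  have : Order.join x 0 <= x + Order.join (- x) 0.
    rewrite leUx; apply/andP; split.
      by apply: (@vle_of_sub (Order.join (- x) 0)); [rewrite leUr|ring].
    by apply: (@vle_of_sub (Order.join (- x) 0 - (- x)));
      [rewrite vsub_ge0 leUl|ring].
  by move=> h; apply: (vle_of_le h); ring.
Qed.

Lemma vpos_ge0 x : 0 <= vpos x. Proof. exact: leUr. Qed.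
Lemma vneg_ge0 x : 0 <= vneg x. Proof. exact: leUr. Qed.
Lemma le_vpos x : x <= vpos x. Proof. exact: leUl. Qed.

Lemma vpos_neg_disj x : Order.meet (vpos x) (vneg x) = 0.
Proof.
apply/eqP; rewrite eq_le lexI vpos_ge0 vneg_ge0 !andbT.
set w := Order.meet _ _.
have w1 : w <= vpos x by exact: leIl.
have w2 : w <= vneg x by exact: leIr.
have : vpos x <= vpos x - w.
  rewrite {1}/vpos leUx vsub_ge0 w1 andbT {1}(vposE x).
  by apply: (vle_of_le w2); ring.
by move=> h; apply: (vle_of_le h); ring.
Qed.

Lemma disj_mul0 x y : Order.meet x y = 0 -> x * y = 0.
Proof.
move=> xy0.
have x0 : 0 <= x by rewrite -xy0 leIl.
have y0 : 0 <= y by rewrite -xy0 leIr.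
have h1 : Order.meet (y * x) y = 0 by exact: fmul_disj.
have h2 : Order.meet (x * y) (y * x) = 0.
  by apply: fmul_disj x0; rewrite /= in h1 *; rewrite -[LHS]/(Order.meet _ _) meetC.
by rewrite [y * x]mulrC meetxx in h2.
Qed.

Lemma vsqr_ge0 x : 0 <= x * x.
Proof.
have h := disj_mul0 (vpos_neg_disj x).
have -> : x * x = vpos x * vpos x + vneg x * vneg x - 2 * (vpos x * vneg x).
  by rewrite {1 2}(vposE x); ring.
rewrite h mulr0 subr0.
by apply: vaddr_ge0; apply: vmulr_ge0; rewrite ?vpos_ge0 ?vneg_ge0.
Qed.

Lemma v1_ge0 : 0 <= 1 :> F.
Proof. by rewrite -[1 in leRHS](mulr1 1); exact: vsqr_ge0. Qed.

Lemma rcst_ge0 r : 0 <= r -> 0 <= rcst r.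
Proof. by move=> r0; apply: vlat_scale_ge0 => //; exact: v1_ge0. Qed.

Lemma rcst_le r t : r <= t -> rcst r <= rcst t.
Proof.
rewrite -subr_ge0 => /rcst_ge0 h.
by apply: (vle_of_sub h); rewrite rmorphB.
Qed.

Lemma vexp_ge0 x n : 0 <= x -> 0 <= x ^+ n.
Proof.
move=> x0; elim: n => [|n IH]; first by rewrite expr0 v1_ge0.
by rewrite exprS; exact: vmulr_ge0.
Qed.

Lemma vexp_le x y n : 0 <= x -> x <= y -> x ^+ n <= y ^+ n.
Proof.
move=> x0 xy; elim: n => [|n IH]; first by rewrite !expr0.
rewrite !exprS; apply: (@le_trans _ _ (x * y ^+ n)).
  exact: vler_wpM2l.
rewrite !(mulrC _ (y ^+ n)); apply: vler_wpM2l => //.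
by apply: vexp_ge0; exact: le_trans xy.
Qed.

(** ** Suprema *)

Lemma vsup_exists (A : set F) b :
  A !=set0 -> (forall x, A x -> x <= b) -> exists s, supremums A s.
Proof. by move=> A0 Ab; apply: dedekind_complete => //; exists b => x /Ab. Qed.

Lemma supremums_le (A : set F) s x : supremums A s -> A x -> x <= s.
Proof. by case=> + _; apply. Qed.

Lemma supremums_lub (A : set F) s b :
  supremums A s -> (forall x, A x -> x <= b) -> s <= b.
Proof. by case=> _ h Ab; apply: h => x /Ab. Qed.

Lemma supremumsE (A : set F) s : supremums A s -> supremum 0 A = s.
Proof.
move=> hs; rewrite /supremum; case: ifPn => [/eqP A0|_].
  have h b : s <= b by apply: (supremums_lub hs); rewrite A0.
  have h1 : 0 <= - 1 :> F by apply: (vle_of_le (h (s - 1))); ring. have e10 : (1 : F) = 0.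
    by apply/eqP; rewrite eq_le v1_ge0 andbT -vsub_ge0 sub0r.
  by rewrite -[s]mulr1 e10 mulr0.
by case: xgetP => [y -> hy|/(_ s)//]; exact: is_subset1_supremums hs.
Qed.

(** The infinite distributive law of a lattice-ordered group. *)
Lemma supremums_meet (A : set F) s b c :
  supremums A s -> (forall x, A x -> Order.meet x b <= c) -> Order.meet s b <= c.
Proof.
move=> hs h.
have : s <= s - (Order.meet s b - c).
  apply: (supremums_lub hs) => x Ax; apply: vle_addr.
  have xs := supremums_le hs Ax.
  have h1 : Order.meet s b <= Order.meet x b + (s - x).
    suff h2 : Order.meet s b - (s - x) <= Order.meet x b.
      by apply: (vle_of_le h2); ring.
    rewrite lexI; apply/andP; split.
      by apply: (vle_of_le (leIl s b)); ring.
    apply: le_trans (leIr b s); apply: (vle_of_le xs); ring.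
  by apply: (vle_of_le (vleD h1 (h _ Ax))); ring.
by move=> h'; apply: (vle_of_le h'); ring.
Qed.

Lemma archimedean x y : (forall n, rcst n%:R * x <= y) -> x <= 0.
Proof.
move=> h; have [s hs] : exists s, supremums [set rcst n%:R * x | n in setT] s.
  apply: (@vsup_exists _ y); first by exists (rcst 0%:R * x); exists 0%N.
  by move=> _ [n _ <-]; exact: h.
have : s <= s - x.
  apply: (supremums_lub hs) => _ [n _ <-]; apply: vle_addr.
  have -> : rcst n%:R * x + x = rcst n.+1%:R * x by ring.
  by apply: (supremums_le hs); exists n.+1.
by move=> h'; apply: (vle_of_le h'); ring.
Qed.

End FAlgebra.

(** * Local comparison on idempotents *)

Section Cells.
Context (R : realType) (F : univCompleteType R).
Implicit Types (x y z p q s : F) (r t : R) (n : nat).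
Local Notation rcst := (@rcst R F).

Definition cell q := q * q = q /\ q <> 0.

Definition le_on q x y : Prop := 0 <= q * (y - x).

(** The band projection of the identity onto the band generated by the positive
    part of [x]. *)
Definition supp x : F :=
  supremum 0 [set Order.meet (1 : F) (rcst n%:R * vpos x) | n in [set: nat]].

Lemma idem_ge0 q : q * q = q -> 0 <= q.
Proof. by move<-; exact: vsqr_ge0. Qed.

Lemma idem_compl q : q * q = q -> (1 - q) * (1 - q) = 1 - q.
Proof. by move=> h; ring: h. Qed.

Lemma idemM p q : p * p = p -> q * q = q -> p * q * (p * q) = p * q.
Proof. by move=> hp hq; ring: hp hq. Qed.

Lemma idem_le1 q : q * q = q -> q <= 1.
Proof. by move/idem_compl/idem_ge0; rewrite vsub_ge0. Qed.

Lemma supp_sup x :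
  supremums [set Order.meet (1 : F) (rcst n%:R * vpos x) | n in [set: nat]] (supp x).
Proof.
have [s hs] : exists s,
    supremums [set Order.meet (1 : F) (rcst n%:R * vpos x) | n in [set: nat]] s.
  apply: (@vsup_exists _ _ _ 1); first by eexists; exists 0%N.
  by move=> _ [n _ <-]; exact: leIl.
by rewrite /supp (supremumsE hs).
Qed.

Lemma supp_disj x y : Order.meet (vpos x) y = 0 -> Order.meet (supp x) y = 0.
Proof.
move=> xy; have y0 : 0 <= y by rewrite -xy leIr.
have s0 : 0 <= supp x.
  apply: le_trans (supremums_le (supp_sup x) _); last by exists 0%N.
  by rewrite rmorph0 mul0r lexI v1_ge0 lexx.
apply/eqP; rewrite eq_le lexI s0 y0 !andbT.
apply: (supremums_meet (supp_sup x)) => _ [n _ <-].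
have h : Order.meet (rcst n%:R * vpos x) y = 0.
  by apply: fmul_disj => //; exact: rcst_ge0.
by rewrite -h lexI; apply/andP; split;
  [apply: le_trans (leIl _ _) (leIr _ _)|exact: leIr].
Qed.

(** An element [w] below both can be added to every [1 /\ n x^+] without leaving
    the bound [1 /\ (n + 1) x^+], hence [supp x + w <= supp x]. *)
Lemma vpos_supp_compl x : Order.meet (vpos x) (1 - supp x) = 0.
Proof.
have hs := supp_sup x.
have s1 : supp x <= 1.
  by apply: (supremums_lub hs) => _ [n _ <-]; exact: leIl.
apply/eqP; rewrite eq_le lexI vpos_ge0 vsub_ge0 s1 !andbT.
set w := Order.meet _ _.
have w1 : w <= vpos x by exact: leIl.
have w2 : w <= 1 - supp x by exact: leIr.
suff h : supp x <= supp x - w by apply: (vle_of_le h); ring.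
apply: (supremums_lub hs) => _ [n _ <-]; apply: vle_addr.
apply: (@le_trans _ _ (Order.meet (1 : F) (rcst n.+1%:R * vpos x))); last first.
  by apply: (supremums_le hs); exists n.+1.
rewrite lexI; apply/andP; split.
  have h : Order.meet (1 : F) (rcst n%:R * vpos x) <= supp x.
    by apply: (supremums_le hs); exists n.
  by apply: (vle_of_le (vleD h w2)); ring.
by apply: (vle_of_le (vleD (leIr (rcst n%:R * vpos x) 1) w1)); ring.
Qed.

Lemma supp_idem x : supp x * supp x = supp x.
Proof.
have h := disj_mul0 (supp_disj (vpos_supp_compl x)).
by apply/eqP; rewrite eq_sym -subr_eq0 -{1}[supp x]mulr1 -mulrBr h.
Qed.

Lemma supp_mul x : supp x * x = vpos x.
Proof.
have h1 := disj_mul0 (vpos_supp_compl x).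
have h2 := disj_mul0 (supp_disj (vpos_neg_disj x)).
rewrite {2}(vposE x) mulrBr h2 subr0.
by apply/eqP; rewrite eq_sym -subr_eq0 -{1}[vpos x]mulr1 mulrC -mulrBl mulrC h1.
Qed.

Lemma vpos_id x : 0 <= x -> vpos x = x.
Proof. by move=> x0; rewrite /vpos; apply/eqP; rewrite eq_le leUx lexx x0 leUl. Qed.

Lemma supp_ge0_mul x : 0 <= x -> supp x * x = x.
Proof. by move=> x0; rewrite supp_mul vpos_id. Qed.

Lemma supp_min x p : p * p = p -> 0 <= x -> p * x = x -> supp x * p = supp x.
Proof.
move=> pp x0 px; have p0 := idem_ge0 pp; have p1 := idem_ge0 (idem_compl pp).
have h : supp x <= p.
  apply: (supremums_lub (supp_sup x)) => _ [n _ <-]; rewrite vpos_id //.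
  set w := Order.meet _ _.
  have w1 : w <= 1 by exact: leIl.
  have w2 : w <= rcst n%:R * x by exact: leIr.
  have h1 := vler_wpM2l p0 w1.
  have h2 := vler_wpM2l p1 w2.
  have e : (1 - p) * (rcst n%:R * x) = 0 by rewrite -px; ring: pp.
  by rewrite e in h2; apply: (vle_of_le (vleD h1 h2)); ring.
have h1 := vler_wpM2l p1 h.
rewrite (_ : (1 - p) * p = 0) in h1; last by ring: pp.
have h2 := vmulr_ge0 p1 (idem_ge0 (supp_idem x)).
have e : (1 - p) * supp x = 0 by apply/eqP; rewrite eq_le h1 h2.
by rewrite -[RHS]subr0 -e; ring.
Qed.

Lemma cell_rcst q r : cell q -> 0 <= q * rcst r -> 0 <= r.
Proof.
move=> [qq q0] h; rewrite leNgt; apply/negP => r0; apply: q0.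
apply/eqP; rewrite eq_le idem_ge0 // andbT.
have h1 : 0 <= rcst (- r^-1) by apply: rcst_ge0; rewrite oppr_ge0 invr_le0 ltW.
have e : rcst (- r^-1) * rcst r = - 1.
  by rewrite -rmorphM mulNr mulVf ?lt_eqF // rmorphN rmorph1.
apply: (vle_of_sub (vmulr_ge0 h1 h)).
by rewrite mulrCA e; ring.
Qed.

Lemma le_on_rcst q r t : cell q -> le_on q (rcst r) (rcst t) -> r <= t.
Proof.
by move=> hq h; rewrite -subr_ge0; apply: (cell_rcst hq); rewrite rmorphB.
Qed.

Lemma le_on_sub q q' x y : q' * q' = q' -> q' * q = q' -> le_on q x y -> le_on q' x y.
Proof.
move=> /idem_ge0 h e; rewrite /le_on => h'; apply: (vge0_eq (vmulr_ge0 h h')).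
by rewrite mulrA e.
Qed.

Lemma le_on_le q x y : q * q = q -> x <= y -> le_on q x y.
Proof.
by move=> qq xy; apply: vmulr_ge0; [exact: idem_ge0|rewrite vsub_ge0].
Qed.

Lemma le_on_trans q y x z : le_on q x y -> le_on q y z -> le_on q x z.
Proof.
by move=> h1 h2; apply: (vge0_eq (vaddr_ge0 h1 h2)); ring.
Qed.

Lemma le_onD q x y z u : le_on q x y -> le_on q z u -> le_on q (x + z) (y + u).
Proof. by move=> h1 h2; apply: (vge0_eq (vaddr_ge0 h1 h2)); ring. Qed.

(** By the Archimedean property [x - y - r] still has a nonzero positive part for
    some [r > 0]; the cell is the support of that part. *)
Lemma nle_gap x y : ~ x <= y ->
  exists q r, [/\ cell q, 0 < r & le_on q (y + rcst r) x].
Proof.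
move=> nxy.
have [r [r0 hr]] : exists r, 0 < r /\ ~ x - y <= rcst r.
  apply: contrapT => /forallNP h; apply: nxy.
  suff h' : x - y <= 0 by apply: (vle_of_le h'); ring.
  apply: (@archimedean _ _ _ 1) => -[|n].
    by rewrite rmorph0 mul0r; exact: v1_ge0.
  have /not_andP[|/contrapT] := h n.+1%:R^-1; first by rewrite invr_gt0 ltr0n.
  move/(vler_wpM2l (rcst_ge0 _ (ler0n R n.+1))).
  by rewrite -rmorphM mulfV ?pnatr_eq0 // rmorph1.
exists (supp (x - y - rcst r)), r; split.
- split; first exact: supp_idem.
  move=> s0; apply: hr.
  have := supp_mul (x - y - rcst r); rewrite s0 mul0r => p0.
  have := le_vpos (x - y - rcst r); rewrite -p0 => h.
  by apply: (vle_of_le h); ring.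
- by [].
- by rewrite /le_on opprD addrA supp_mul vpos_ge0.
Qed.

(** The basic case distinction of local arguments. *)
Lemma le_on_or q x y : q * q = q -> le_on q x y \/
  exists q' r, [/\ cell q', q' * q = q', 0 < r & le_on q' (y + rcst r) x].
Proof.
move=> qq.
have [h|/nle_gap [p [r [[pp p0] r0 h]]]] := pselect (q * x <= q * y).
  by left; apply: (vge0_eq (_ : 0 <= q * y - q * x)); [rewrite vsub_ge0|ring].
right; exists (p * q), r; split => //; first split.
- exact: idemM.
- move=> pq0; apply: p0; apply/eqP; rewrite eq_le idem_ge0 // andbT.
  have h1 : 0 <= p * rcst (- r).
    by apply: (vge0_eq h); rewrite rmorphN; ring: pq0.
  have [//|p0] := pselect (p <= 0).
  have : 0 <= - r.
    by apply: (cell_rcst _ h1); split => // p1; apply: p0; rewrite p1.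
  by rewrite oppr_ge0 leNgt r0.
- by ring: qq.
- by apply: (vge0_eq (vmulr_ge0 (idem_ge0 qq) h)); ring: qq.
Qed.

(** Otherwise [x] would be above every multiple of [q]. *)
Lemma le_on_bounded q x : cell q ->
  exists q' r, [/\ cell q', q' * q = q', 0 <= r & le_on q' x (rcst r)].
Proof.
move=> hq; have [qq q0] := hq; apply: contrapT => h.
apply: q0; apply/eqP; rewrite eq_le idem_ge0 // andbT.
apply: (@archimedean _ _ _ (q * x)) => n.
have [h'|[q' [r [hq' q'q r0 h']]]] := le_on_or (rcst n%:R) x qq.
  by apply: (vle_of_sub h'); ring.
exfalso; apply: h; exists q', n%:R; split => //.
have h1 : le_on q' x (x + rcst r).
  by apply: le_on_le; [case: hq'|apply: (vle_of_sub (rcst_ge0 _ (ltW r0))); ring].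
exact: le_on_trans h1 h'.
Qed.

(** Climb from [r] in steps of [e]: at each level [le_on_or] either stops at the
    current cell or moves one step up on a smaller one. *)
Lemma le_on_approx_up q x r e k : cell q -> 0 < e -> le_on q (rcst r) x ->
  le_on q x (rcst (r + k%:R * e)) ->
  exists q' t, [/\ cell q', q' * q = q', r <= t, le_on q' (rcst t) x &
    le_on q' x (rcst (t + e))].
Proof.
move=> + e0; elim: k q r => [|k IH] q r hq h1 h2; have [qq q0] := hq.
  exists q, r; split => //; apply: le_on_trans h2 _; apply: le_on_le => //.
  by apply: rcst_le; lra.
have [h|[q1 [d [hq1 q1q d0 h]]]] := le_on_or x (rcst (r + e)) qq.
  by exists q, r; split.
have [q1q1 _] := hq1.
have h3 : le_on q1 (rcst (r + e)) x.
  apply: le_on_trans h; apply: le_on_le => //; rewrite -rmorphD.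
  by apply: rcst_le; lra.
have h4 : le_on q1 x (rcst (r + e + k%:R * e)).
  apply: (le_on_sub q1q1 q1q); rewrite (_ : r + e + _ = r + k.+1%:R * e) //.
  by rewrite -natr1; ring.
have [q2 [t [hq2 q2q1 rt h5 h6]]] := IH _ _ hq1 h3 h4.
exists q2, t; split => //; last by lra.
by rewrite -q2q1 -mulrA q1q.
Qed.

Lemma le_on_approx_ge q x r e : cell q -> 0 < e -> le_on q (rcst r) x ->
  exists q' t, [/\ cell q', q' * q = q', r <= t, le_on q' (rcst t) x &
    le_on q' x (rcst (t + e))].
Proof.
move=> hq e0 h; have [q1 [c [hq1 q1q c0 h1]]] := le_on_bounded x hq.
have [q1q1 _] := hq1.
have [k hk] : exists k : nat, c <= r + k%:R * e.
  exists (Num.truncn ((c - r) / e)).+1.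
  have := truncnS_gt ((c - r) / e); rewrite ltr_pdivrMr // => ?; lra.
have h2 : le_on q1 x (rcst (r + k%:R * e)).
  by apply: le_on_trans h1 _; apply: le_on_le => //; exact: rcst_le.
have [q2 [t [hq2 q2q1 rt h3 h4]]] :=
  le_on_approx_up hq1 e0 (le_on_sub q1q1 q1q h) h2.
by exists q2, t; split => //; rewrite -q2q1 -mulrA q1q.
Qed.

Lemma le_on_approx q x e : cell q -> 0 < e ->
  exists q' t, [/\ cell q', q' * q = q', le_on q' (rcst t) x &
    le_on q' x (rcst (t + e))].
Proof.
move=> hq e0; have [q1 [c [hq1 q1q c0 h1]]] := le_on_bounded (- x) hq.
have h2 : le_on q1 (rcst (- c)) x.
  by apply: (vge0_eq h1); rewrite rmorphN; ring.
have [q2 [t [hq2 q2q1 _ h3 h4]]] := le_on_approx_ge hq1 e0 h2.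
by exists q2, t; split => //; rewrite -q2q1 -mulrA q1q.
Qed.

(** Together with [supp_lower]: [supp x] is made of the cells on which [x] has a
    positive lower bound. *)
Lemma supp_of_lower q r x : q * q = q -> 0 < r -> 0 <= x -> le_on q (rcst r) x ->
  q * supp x = q.
Proof.
move=> qq r0 x0 h; apply: contrapT => ne.
have ss := supp_idem x; have e := supp_ge0_mul x0.
have cq : cell (q * (1 - supp x)).
  split; first exact: idemM (idem_compl ss).
  by rewrite mulrBr mulr1 => /eqP; rewrite subr_eq0 eq_sym => /eqP.
have : 0 <= - r.
  apply: (cell_rcst cq).
  apply: (vge0_eq (vmulr_ge0 (idem_ge0 (idem_compl ss)) h)).
  by rewrite rmorphN; ring: e.
by rewrite oppr_ge0 leNgt r0.
Qed.

Lemma supp_lower q x : q * q = q -> 0 <= x -> q * supp x <> 0 ->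
  exists q' r, [/\ cell q', q' * q = q', 0 < r & le_on q' (rcst r) x].
Proof.
move=> qq x0 ne.
have [h|[q' [r [hq' q'q r0 h]]]] := le_on_or x 0 qq; last first.
  by exists q', r; split; rewrite ?add0r in h *.
have qx : q * x = 0.
  apply/eqP; rewrite eq_le (vmulr_ge0 (idem_ge0 qq) x0) andbT.
  by apply: (vle_of_sub h); ring.
case: ne; have := @supp_min x (1 - q) (idem_compl qq) x0.
rewrite mulrBl qx subr0 mul1r => /(_ erefl).
move=> e; have <- : supp x - supp x * (1 - q) = 0 by rewrite e subrr.
by ring.
Qed.

End Cells.

(** * Roots *)

Section Roots.
Context (R : realType) (F : univCompleteType R).
Implicit Types (x y z p q s d : F) (r t e : R) (n : nat).
Local Notation rcst := (@rcst R F).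

Lemma le_onM q x y z u : q * q = q -> le_on q 0 y -> le_on q 0 z ->
  le_on q x y -> le_on q z u -> le_on q (x * z) (y * u).
Proof.
rewrite /le_on !subr0 => qq y0 z0 h1 h2.
apply: (vge0_eq (vaddr_ge0 (vmulr_ge0 y0 h2) (vmulr_ge0 z0 h1))).
by ring: qq.
Qed.

Lemma le_on_ge0 q x : q * q = q -> 0 <= x -> le_on q 0 x.
Proof. exact: le_on_le. Qed.

Lemma le_on_exp q x y n : q * q = q -> le_on q 0 x -> le_on q x y ->
  le_on q (x ^+ n) (y ^+ n).
Proof.
move=> qq x0 xy.
have [//] : le_on q 0 (x ^+ n) /\ le_on q (x ^+ n) (y ^+ n).
elim: n => [|n [IH1 IH2]].
  by rewrite !expr0; split; apply: le_on_le; rewrite ?lexx ?v1_ge0.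
rewrite !exprS; split; last by apply: le_onM => //; exact: le_on_trans xy.
rewrite /le_on !subr0 in x0 IH1 *.
by apply: (vge0_eq (vmulr_ge0 x0 IH1)); ring: qq.
Qed.

Lemma vexpD_ge x y n : (0 < n)%N -> 0 <= x -> 0 <= y ->
  x ^+ n + y ^+ n <= (x + y) ^+ n.
Proof.
case: n => // n _ x0 y0; elim: n => [//|n IH].
rewrite (exprS (x + y)).
have h1 := vler_wpM2l (vaddr_ge0 x0 y0) IH.
apply: le_trans h1.
have h2 := vaddr_ge0 (vmulr_ge0 x0 (vexp_ge0 n.+1 y0))
  (vmulr_ge0 y0 (vexp_ge0 n.+1 x0)).
by apply: (vle_of_sub h2); rewrite !(exprS _ n.+1); ring.
Qed.

(** Convexity of the power along [[z, z + 1]]. *)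
Lemma vexpD_le z d n : 0 <= z -> 0 <= d -> d <= 1 ->
  (z + d) ^+ n <= z ^+ n + d * ((z + 1) ^+ n - z ^+ n).
Proof.
move=> z0 d0 d1; elim: n => [|n IH].
  by rewrite !expr0 subrr mulr0 addr0.
have D0 : 0 <= (z + 1) ^+ n - z ^+ n.
  rewrite vsub_ge0; apply: vexp_le => //.
  by apply: (vle_of_sub (v1_ge0 F)); ring.
rewrite (exprS (z + d)).
apply: le_trans (vler_wpM2l (vaddr_ge0 z0 d0) IH) _.
rewrite -vsub_ge0 in d1.
apply: (vle_of_sub (vmulr_ge0 (vmulr_ge0 d0 D0) d1)).
by rewrite !exprS; ring.
Qed.

Lemma le_on_root q x y n : (0 < n)%N -> q * q = q -> 0 <= x -> 0 <= y ->
  le_on q (x ^+ n) (y ^+ n) -> le_on q x y.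
Proof.
move=> n0 qq x0 y0 h.
have [//|[p [r [hp pq r0 hpr]]]] := le_on_or x y qq; have [pp _] := hp.
have yr0 : 0 <= y + rcst r by apply: vaddr_ge0 => //; apply/rcst_ge0/ltW.
have h1 := le_on_exp n pp (le_on_ge0 pp yr0) hpr.
have h2 := le_on_le pp (vexpD_ge n0 y0 (rcst_ge0 F (ltW r0))).
have h3 := le_on_trans h2 (le_on_trans h1 (le_on_sub pp pq h)).
have : 0 <= - r ^+ n.
  apply: (cell_rcst hp); rewrite rmorphN rmorphXn.
  by apply: (vge0_eq h3); ring.
by rewrite oppr_ge0 leNgt exprn_gt0.
Qed.

Lemma vroot_le x y n : (0 < n)%N -> 0 <= x -> 0 <= y -> x ^+ n <= y ^+ n -> x <= y.
Proof.
move=> n0 x0 y0 h.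
have := @le_on_root 1 x y n n0 (mulr1 1) x0 y0.
by rewrite /le_on !mul1r !vsub_ge0; apply.
Qed.

Lemma vroot_inj x y n : (0 < n)%N -> 0 <= x -> 0 <= y -> x ^+ n = y ^+ n -> x = y.
Proof.
move=> n0 x0 y0 h; apply/eqP; rewrite eq_le.
by apply/andP; split; apply: (@vroot_le _ _ n) => //; rewrite h.
Qed.

Lemma idem_exp q n : q * q = q -> q ^+ n.+1 = q.
Proof. by move=> qq; elim: n => [//|n IH]; rewrite exprS IH. Qed.

(** The supremum of the subsolutions of [y ^+ n <= x] solves the equation: at a
    gap it could be raised or lowered by a small constant, by the convexity
    bound [vexpD_le]. *)
Lemma vroot_exists x n : (0 < n)%N -> 0 <= x -> exists y, 0 <= y /\ y ^+ n = x.
Proof.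
move=> n0 x0; pose S := [set y : F | 0 <= y /\ y ^+ n <= x].
have S0 : S 0 by split => //; rewrite expr0n gtn_eqF.
have [s hs] : exists s, supremums S s.
  apply: (@vsup_exists _ _ _ (x + 1)); first by exists 0.
  move=> y [y0 yx].
  have x10 : 0 <= x + 1 by apply: vaddr_ge0 => //; exact: v1_ge0.
  apply: (@vroot_le _ _ n) => //; apply: le_trans yx _.
  apply: (@le_trans _ _ (x + 1)).
    by apply: (vle_of_sub (v1_ge0 F)); ring.
  case: n n0 {S S0} => // n _; rewrite exprS -[leLHS]mulr1.
  apply: vler_wpM2l => //; apply: (@le_trans _ _ ((1 : F) ^+ n)).
    by rewrite expr1n.
  apply: vexp_le; first exact: v1_ge0.
  by apply: (vle_of_sub x0); ring.
have s0 : 0 <= s by exact: supremums_le hs S0.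
(* a constant shift of size [e] changes [n]-th powers by less than [r]
   wherever [s] is at most [c] *)
have shift (c r : R) : 0 <= c -> 0 < r ->
    exists e, [/\ 0 < e, e <= 1 & forall q y, q * q = q -> 0 <= y ->
      le_on q y (rcst c) -> le_on q ((y + rcst e) ^+ n) (y ^+ n + rcst r)].
  move=> c0 r0; pose K := (c + 1) ^+ n.
  have K0 : 0 < K by apply: exprn_gt0; lra.
  exists (Num.min 1 (r / K)); split.
  - by rewrite lt_min ltr01 divr_gt0.
  - by rewrite ge_min lexx.
  move=> q y qq y0 yc; set e := Num.min _ _.
  have e0 : 0 <= e by rewrite le_min ler01 divr_ge0 // ltW.
  have e1 : rcst e <= 1 by rewrite -(rmorph1 rcst); apply: rcst_le; rewrite ge_min lexx.
  have eK : e * K <= r by rewrite -ler_pdivlMr // ge_min lexx orbT.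
  apply: le_on_trans (le_on_le qq (vexpD_le n y0 (rcst_ge0 F e0) e1)) _.
  have h1 : le_on q ((y + 1) ^+ n) (rcst K).
    rewrite /K rmorphXn; apply: le_on_exp => //.
      by apply: le_on_ge0 => //; apply: vaddr_ge0 => //; exact: v1_ge0.
    by apply: (vge0_eq yc); rewrite rmorphD rmorph1; ring.
  have h2 := vmulr_ge0 (rcst_ge0 F e0) h1.
  have h3 := vmulr_ge0 (idem_ge0 qq) (rcst_ge0 F (_ : 0 <= r - e * K)).
  have h4 := vmulr_ge0 (vmulr_ge0 (idem_ge0 qq) (rcst_ge0 F e0)) (vexp_ge0 n y0).
  rewrite subr_ge0 in h3.
  apply: (vge0_eq (vaddr_ge0 h2 (vaddr_ge0 (h3 eK) h4))).
  by rewrite rmorphB rmorphM; ring.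
exists s; split => //; apply/eqP; rewrite eq_le; apply/andP; split.
- apply: contrapT => /nle_gap [q [r [hq r0 hqr]]].
  have [q1 [c [hq1 q1q c0 hc]]] := le_on_bounded s hq; have [q1q1 q10] := hq1.
  have [e [e0 e1 he]] := shift c (r / 2) c0 (divr_gt0 r0 (ltr0n R 2)).
  have key y : S y -> le_on q1 (y + rcst e) s.
    move=> [y0 yx].
    have yc : le_on q1 y (rcst c).
      by apply: le_on_trans hc; apply: le_on_le => //; exact: supremums_le hs _.
    have [//|[p [d [hp pq1 d0 hpd]]]] := le_on_or (y + rcst e) s q1q1.
    have [pp _] := hp.
    have h1 : le_on p s (y + rcst e).
      apply: le_on_trans hpd; apply: le_on_le => //.
      by apply: (vle_of_sub (rcst_ge0 F (ltW d0))); ring.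
    have h2 := le_on_exp n pp (le_on_ge0 pp s0) h1.
    have h3 := le_on_sub pp pq1 (he _ _ q1q1 y0 yc).
    have h4 := le_on_sub pp pq1 (le_on_sub q1q1 q1q hqr).
    have h5 := vaddr_ge0 (le_on_le pp yx) (vaddr_ge0 h4 (vaddr_ge0 h2 h3)).
    have : 0 <= r / 2 - r.
      by apply: (cell_rcst hp); rewrite rmorphB; apply: (vge0_eq h5); ring.
    by move: r0; clear; lra.
  have : s <= s - rcst e * q1.
    apply: (supremums_lub hs) => y Sy.
    have ys : 0 <= s - y by rewrite vsub_ge0; exact: supremums_le hs Sy.
    have h1 := vmulr_ge0 (idem_ge0 (idem_compl q1q1)) ys.
    by apply: (vle_of_sub (vaddr_ge0 h1 (key _ Sy))); ring.
  move=> h1; have : 0 <= - e.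
    apply: (cell_rcst hq1); rewrite rmorphN.
    by rewrite -vsub_ge0 in h1; apply: (vge0_eq h1); ring.
  by move: e0; clear; lra.
- apply: contrapT => /nle_gap [q [r [hq r0 hqr]]].
  have [q1 [c [hq1 q1q c0 hc]]] := le_on_bounded s hq; have [q1q1 q10] := hq1.
  have [e [e0 e1 he]] := shift c r c0 r0.
  have h1 : q1 * (s + rcst e) <= s.
    apply: (supremums_le hs); split.
      by apply: vmulr_ge0; [exact: idem_ge0|apply: vaddr_ge0 => //; exact/rcst_ge0/ltW].
    rewrite exprMn -(prednK n0) idem_exp // (prednK n0).
    have h2 := le_on_trans (he _ _ q1q1 s0 hc) (le_on_sub q1q1 q1q hqr).
    have h3 := vmulr_ge0 (idem_ge0 (idem_compl q1q1)) x0.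
    by apply: (vle_of_sub (vaddr_ge0 h2 h3)); ring.
  have : 0 <= - e.
    apply: (cell_rcst hq1); rewrite rmorphN.
    by apply: (vge0_eq (le_on_le q1q1 h1)); ring: q1q1.
  by move: e0; clear; lra.
Qed.

Lemma nth_rootP n x : (0 < n)%N -> 0 <= x ->
  0 <= nth_root n x /\ nth_root n x ^+ n = x.
Proof.
move=> n0 x0; rewrite /nth_root.
by case: xgetP => // h; have [y /h] := vroot_exists n0 x0.
Qed.

Lemma nth_root_ge0 n x : 0 <= nth_root n x.
Proof. by rewrite /nth_root; case: xgetP => [y -> []|]. Qed.

End Roots.

(** * The modulus of the complexification *)

Section Modulus.
Context (R : realType) (F : univCompleteType R).
Implicit Types (x y p q s d : F) (z w : cplx F) (r t e : R) (n : nat).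
Local Notation rcst := (@rcst R F).

Lemma polar_coordinates (a b : R) : exists t h : R,
  [/\ t \in `[0, 2 * pi], 0 <= h, h ^+ 2 = a ^+ 2 + b ^+ 2 &
      a = h * cos t /\ b = h * sin t].
Proof.
pose h := Num.sqrt (a ^+ 2 + b ^+ 2).
have ab0 : 0 <= a ^+ 2 + b ^+ 2 by rewrite addr_ge0 ?sqr_ge0.
have hh : h ^+ 2 = a ^+ 2 + b ^+ 2 by rewrite sqr_sqrtr.
have h0 : 0 <= h by exact: sqrtr_ge0.
have pi0 : 0 <= pi :> R by exact: pi_ge0.
have [hz|hn] := eqVneq h 0.
  have /andP [/eqP a0 /eqP b0] : (a == 0) && (b == 0).
    by rewrite -(sqrf_eq0 a) -(sqrf_eq0 b) -paddr_eq0 ?sqr_ge0 // -hh hz expr0n.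
  exists 0, 0; split => //; last by rewrite a0 b0 !mul0r.
  - by rewrite in_itv /= lexx mulr_ge0.
  - by rewrite a0 b0 !expr0n addr0.
have hp : 0 < h by rewrite lt_neqAle eq_sym hn h0.
have ah : -1 <= a / h <= 1.
  rewrite -ler_norml normrM normfV (ger0_norm h0) ler_pdivrMr // mul1r.
  by rewrite -(@ler_pXn2r _ 2) ?nnegrE // real_normK ?num_real // hh lerDl sqr_ge0.
have e1 : a = h * (a / h) by rewrite mulrCA mulfV // mulr1.
have e2 : h * Num.sqrt (1 - (a / h) ^+ 2) = `|b|.
  rewrite -(@sqrtr_sqr _ b) -[X in X * _](@ger0_norm _ h) // -sqrtr_sqr -sqrtrM ?sqr_ge0 //.
  congr Num.sqrt; rewrite mulrBr mulr1 -exprMn -e1 hh; ring.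
have t0 := acos_ge0 ah; have tpi := acos_lepi ah.
have [b0|b0] := leP 0 b.
  exists (acos (a / h)), h; split => //; first by rewrite in_itv /= t0; lra.
  by rewrite acosK // sin_acos // e2 ger0_norm.
exists (2 * pi - acos (a / h)), h; split => //.
  by rewrite in_itv /=; apply/andP; split; lra.
have -> : 2 * pi - acos (a / h) = - acos (a / h) + pi *+ 2 :> R by ring.
by rewrite cosD2pi sinD2pi cosN sinN acosK // sin_acos // mulrN e2 ltr0_norm // opprK.
Qed.

Lemma sqr_le_abs x s : 0 <= s -> x ^+ 2 <= s ^+ 2 -> x <= s.
Proof.
move=> s0 h; apply: le_trans (le_vpos x) _.
apply: (@vroot_le _ _ _ _ 2) => //; first exact: vpos_ge0.
apply: le_trans h; rewrite {2}(vposE x).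
have h := disj_mul0 (vpos_neg_disj x).
by apply: (vle_of_sub (vsqr_ge0 (vneg x))); ring: h.
Qed.

Lemma le_on_sqr_approx q x (a d h : R) : q * q = q -> 0 <= h -> a <= h ->
  le_on q (rcst a) x -> le_on q x (rcst (a + d)) ->
  le_on q (x ^+ 2) (rcst (a ^+ 2 + 2 * h * d + d ^+ 2)).
Proof.
move=> qq h0 ah h1 h2.
have ha : 0 <= h - a by rewrite subr_ge0.
have h3 := vaddr_ge0 (vmulr_ge0 (rcst_ge0 F ha) h1) (vmulr_ge0 (rcst_ge0 F h0) h2).
have h4 := vmulr_ge0 h2 (vaddr_ge0 h2 (vaddr_ge0 h1 h1)).
apply: (vge0_eq (vaddr_ge0 (vaddr_ge0 h3 h3) h4)).
by ring: qq.
Qed.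

Lemma le_on_lincomb_approx q x (a d c : R) : -1 <= c ->
  le_on q (rcst a) x -> le_on q x (rcst (a + d)) ->
  le_on q (rcst (c * a)) (rcst c * x + rcst d).
Proof.
move=> c1 h1 h2; have c0 : 0 <= 1 + c by move: c1; clear; lra.
by apply: (vge0_eq (vaddr_ge0 (vmulr_ge0 (rcst_ge0 F c0) h1) h2)); ring.
Qed.

(** Let [s] be the square root of [re^2 + im^2]. By Cauchy-Schwarz [s] is an upper
    bound. If it exceeded the supremum on a cell, then on a smaller cell both parts
    of [z] would be nearly constant, and the direction [t] of that constant vector
    would give a member of the set close to [s]. *)
Lemma modulus_sup z :
  let A := [set cos t *: cre z + sin t *: cim z | t in `[0, 2 * pi : R]] in
  supremums A (modulus z) /\ (0 <= modulus z /\
    modulus z ^+ 2 = cre z ^+ 2 + cim z ^+ 2).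
Proof.
case: z => x y A; rewrite /= in A *.
have [s [s0 ss]] : exists s, 0 <= s /\ s ^+ 2 = x ^+ 2 + y ^+ 2.
  by apply: vroot_exists => //; apply: vaddr_ge0; exact: vsqr_ge0.
have As u : A u -> u <= s.
  move=> [t _ <-]; apply: sqr_le_abs => //; rewrite ss !scale_rcst.
  have cs : rcst (cos t) ^+ 2 = 1 - rcst (sin t) ^+ 2.
    by rewrite -!rmorphXn cos2sin2 rmorphB rmorph1.
  apply: (vle_of_sub (vsqr_ge0 (rcst (sin t) * x - rcst (cos t) * y))).
  by ring: cs.
have [m hm] : exists m, supremums A m.
  apply: vsup_exists As; exists (cos 0 *: x + sin 0 *: y); exists 0 => //=.
  by rewrite in_itv /= lexx mulr_ge0 ?pi_ge0.
have -> : modulus (Cplx x y) = m by exact: supremumsE.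
suff ms : m = s by split => //; rewrite ms.
apply/eqP; rewrite eq_le (supremums_lub hm As) /=.
apply: contrapT => /nle_gap [q [r [hq r0 hqr]]].
have d0 : 0 < r / 8 by rewrite divr_gt0.
have [q1 [a [hq1 q1q ax xa]]] := le_on_approx x hq d0.
have [q2 [b [hq2 q2q1 b_y yb]]] := le_on_approx y hq1 d0.
have [q2q2 _] := hq2.
have {}ax := le_on_sub q2q2 q2q1 ax; have {}xa := le_on_sub q2q2 q2q1 xa.
have q2q : q2 * q = q2 by rewrite -q2q1 -mulrA q1q.
have [t [h [tI h0 hh [at_ bt]]]] := polar_coordinates a b.
have le_h c : c ^+ 2 <= h ^+ 2 -> c <= h.
  move=> ch; rewrite (le_trans (ler_norm c)) // -(@ler_pXn2r _ 2) ?nnegrE //.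
  by rewrite real_normK ?num_real.
have ah : a <= h by apply: le_h; rewrite hh lerDl sqr_ge0.
have bh : b <= h by apply: le_h; rewrite hh lerDr sqr_ge0.
have hm' : le_on q2 (rcst h) (m + rcst (r / 4)).
  have cm : cos t *: x + sin t *: y <= m by apply: (supremums_le hm); exists t.
  have h1 := le_on_lincomb_approx (cos_geN1 t) ax xa.
  have h2 := le_on_lincomb_approx (sin_geN1 t) b_y yb.
  rewrite !scale_rcst in cm.
  have -> : h = cos t * a + sin t * b.
    rewrite at_ bt -[LHS]mulr1 -(cos2Dsin2 t); ring.
  apply: (vge0_eq (vaddr_ge0 (le_on_le q2q2 cm) (le_onD h1 h2))).
  have -> : r / 4 = r / 8 + r / 8 by field.
  by ring.
have hs : le_on q2 s (rcst (h + r / 4)).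
  apply: (@le_on_root _ _ _ _ _ 2) => //.
    by apply: rcst_ge0; move: h0 r0; clear; lra.
  have h1 := le_onD (le_on_sqr_approx q2q2 h0 ah ax xa)
                    (le_on_sqr_approx q2q2 h0 bh b_y yb).
  rewrite -ss -rmorphD in h1; apply: le_on_trans h1 _; rewrite -rmorphXn.
  apply: le_on_le => //; apply: rcst_le.
  have : 0 <= (r / 8) ^+ 2 by exact: sqr_ge0.
  by move: hh; clear; nra.
have := le_on_sub q2q2 q2q hqr => h1.
have : 0 <= r / 4 + r / 4 - r.
  apply: (cell_rcst hq2); apply: (vge0_eq (vaddr_ge0 h1 (vaddr_ge0 hm' hs))).
  by ring.
by move: r0; clear; lra.
Qed.

Lemma modulus_ge0 z : 0 <= modulus z.
Proof. by have [_ []] := modulus_sup z. Qed.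

Lemma modulus_sqr z : modulus z ^+ 2 = cre z ^+ 2 + cim z ^+ 2.
Proof. by have [_ []] := modulus_sup z. Qed.

Lemma modulus_unique z x : 0 <= x -> x ^+ 2 = cre z ^+ 2 + cim z ^+ 2 ->
  modulus z = x.
Proof.
by move=> x0 h; apply: (@vroot_inj _ _ _ _ 2); rewrite ?modulus_ge0 ?modulus_sqr.
Qed.

Lemma modulusM z w : modulus (z * w) = modulus z * modulus w.
Proof.
apply: modulus_unique; first by apply: vmulr_ge0; exact: modulus_ge0.
by rewrite exprMn !modulus_sqr /=; ring.
Qed.

Lemma modulus_real x : 0 <= x -> modulus (Cplx x 0) = x.
Proof. by move=> x0; apply: modulus_unique => //=; ring. Qed.

Lemma modulusX z n : modulus (z ^+ n) = modulus z ^+ n.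
Proof.
elim: n => [|n IH]; last by rewrite !exprS modulusM IH.
by rewrite !expr0 modulus_real ?v1_ge0.
Qed.

Lemma modulusN z : modulus (- z) = modulus z.
Proof. by apply: modulus_unique; rewrite ?modulus_ge0 // modulus_sqr /=; ring. Qed.

Lemma modulusD z w : modulus (z + w) <= modulus z + modulus w.
Proof.
have [h _] := modulus_sup (z + w); apply: (supremums_lub h) => _ [t tI <-].
have [[hz _] _] := modulus_sup z; have [[hw _] _] := modulus_sup w.
have h1 : cos t *: cre z + sin t *: cim z <= modulus z by apply: hz; exists t.
have h2 : cos t *: cre w + sin t *: cim w <= modulus w by apply: hw; exists t.
by apply: (vle_of_le (vleD h1 h2)); rewrite /= !scalerDr; ring.
Qed.

Lemma cre_le_modulus z : cre z <= modulus z.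
Proof.
apply: sqr_le_abs; rewrite ?modulus_ge0 // modulus_sqr.
by apply: (vle_of_sub (vsqr_ge0 (cim z))); ring.
Qed.

Lemma cim_le_modulus z : cim z <= modulus z.
Proof.
apply: sqr_le_abs; rewrite ?modulus_ge0 // modulus_sqr.
by apply: (vle_of_sub (vsqr_ge0 (cre z))); ring.
Qed.

Lemma modulus_le z d : 0 <= d -> - d <= cre z <= d -> - d <= cim z <= d ->
  modulus z <= d + d.
Proof.
move=> d0 /andP[x1 x2] /andP[y1 y2].
apply: sqr_le_abs; first exact: vaddr_ge0.
rewrite modulus_sqr -!(vsub_ge0 _ d) -!(vsub_ge0 (- d)) in x1 x2 y1 y2 *.
have h := vaddr_ge0 (vmulr_ge0 x1 x2) (vmulr_ge0 y1 y2).
apply: (vle_of_sub (vaddr_ge0 h (vaddr_ge0 (vsqr_ge0 d) (vsqr_ge0 d)))).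
by ring.
Qed.

End Modulus.

(** * Elements of the sup-completion *)

Section SupCompletion.
Context (R : realType) (F : univCompleteType R) (Fs : orderedConeType R).
Context (iota : F -> Fs) (hFs : is_sup_completion iota).
Implicit Types (x y z p q : F) (u v : Fs) (r t : R) (n : nat).
Local Notation rcst := (@rcst R F).

Lemma iota_le x y : (iota x <= iota y) = (x <= y).
Proof. exact: sc_le. Qed.

Lemma s_sup_exists (A : set Fs) : A !=set0 -> exists s, supremums A s.
Proof.
move=> A0; apply: (sc_sup hFs A0).
by have [t ht] := sc_top hFs; exists t => y _.
Qed.

Lemma s_supremumE (A : set Fs) s : A !=set0 -> supremums A s -> supremum (0 : Fs) A = s.
Proof.
move=> /set0P/negPf A0 hs; rewrite /supremum A0.
by case: xgetP => [y _ hy|/(_ s)//]; exact: (@is_subset1_supremums _ _ A _ _ hy hs).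
Qed.

Lemma s_infimumE (A : set Fs) s : A !=set0 -> infimums A s -> infimum (0 : Fs) A = s.
Proof.
move=> /set0P/negPf A0 hs; rewrite /infimum A0.
by case: xgetP => [y _ hy|/(_ s)//]; exact: (@is_subset1_infimums _ _ A _ _ hy hs).
Qed.

Lemma s_le_dense u v : (forall x, iota x <= u -> iota x <= v) -> u <= v.
Proof. by move=> h; have [_] := sc_dense hFs u; apply => _ [x /h xv <-]. Qed.

Lemma s_le_down x y u : x <= y -> iota y <= u -> iota x <= u.
Proof. by move=> xy; apply: le_trans; rewrite iota_le. Qed.

Lemma fin_part_iota x : fin_part iota (iota x) = x.
Proof.
rewrite /fin_part; case: xgetP => [y _ /= /eqP|/(_ x) []//].
by rewrite eq_le !iota_le -eq_le => /eqP.
Qed.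

Lemma fin_part_meet x u :
  iota (fin_part iota (Order.meet (iota x) u)) = Order.meet (iota x) u.
Proof.
have [y _ <-] := sc_solid hFs (leIl (iota x) u).
by rewrite fin_part_iota.
Qed.

Definition trunc u x : F := fin_part iota (Order.meet (iota x) u).

Lemma le_trunc u x y : (y <= trunc u x) <-> (y <= x /\ iota y <= u).
Proof.
rewrite -iota_le fin_part_meet lexI iota_le.
by split => [/andP//|[-> ->]].
Qed.

Lemma trunc_le u x : trunc u x <= x /\ iota (trunc u x) <= u.
Proof. exact/le_trunc. Qed.

Lemma trunc_ge0 u x : iota 0 <= u -> 0 <= x -> 0 <= trunc u x.
Proof. by move=> u0 x0; apply/le_trunc. Qed.

Lemma s_join_le x y u : iota x <= u -> iota y <= u -> iota (Order.join x y) <= u.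
Proof.
move=> xu yu; have xj : x <= Order.join x y by exact: leUl.
have yj : y <= Order.join x y by exact: leUr.
have [/= _ h] := trunc_le u (Order.join x y).
apply: s_le_down h; rewrite leUx.
by apply/andP; split; apply/le_trunc.
Qed.

Lemma s_vpos_le x u : iota 0 <= u -> iota x <= u -> iota (vpos x) <= u.
Proof. by move=> u0 xu; exact: s_join_le. Qed.

Lemma iota_scale r x : 0 <= r -> iota (rcst r * x) = Defs.cscale r (iota x).
Proof. by move=> r0; rewrite -scale_rcst (sc_Z hFs). Qed.

Lemma s_le_scale r x u : 0 < r ->
  iota x <= Defs.cscale r u <-> iota (rcst r^-1 * x) <= u.
Proof.
move=> r0; have r0' := ltW r0; have i0 : 0 <= r^-1 by rewrite invr_ge0.
rewrite iota_scale //; split => [/(cone_leZ _ _ _ i0)|/(cone_leZ _ _ _ r0')].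
  by rewrite Defs.cscaleA // mulVf ?gt_eqF // Defs.cscale1.
by rewrite Defs.cscaleA // mulfV ?gt_eqF // Defs.cscale1.
Qed.

Lemma s_mulrn u n : u *+ n = Defs.cscale n%:R u.
Proof.
elim: n => [|n IH]; first by rewrite mulr0n Defs.cscale0.
by rewrite mulrSr IH -natr1 Defs.cscaleDl ?ler0n // Defs.cscale1.
Qed.

(** ** Values on cells *)

(** The projection of the identity onto the band of [u], computed from the
    truncation of [u] at the identity, which lies in [F]. *)
Definition s_supp u : F := supp (trunc u 1).

Definition s_le_on u q r := forall x, iota x <= u -> le_on q x (rcst r).

Lemma s_supp_idem u : s_supp u * s_supp u = s_supp u.
Proof. exact: supp_idem. Qed.

Lemma s_lower_of_le_on u q r y : iota 0 <= u -> q * q = q -> iota y <= u ->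
  le_on q (rcst r) y -> iota (rcst r * q) <= u.
Proof.
move=> u0 qq /(s_vpos_le u0) yu h; apply: s_le_down yu.
have h1 := le_on_le qq (le_vpos y).
have h2 := vmulr_ge0 (idem_ge0 (idem_compl qq)) (vpos_ge0 y).
by apply: (vle_of_sub (vaddr_ge0 h (vaddr_ge0 h1 h2))); ring.
Qed.

Lemma s_lower_sub u q q' r : 0 <= r -> q * q = q -> q' * q' = q' -> q' * q = q' ->
  iota (rcst r * q) <= u -> iota (rcst r * q') <= u.
Proof.
move=> r0 qq q'q' q'q; apply: s_le_down; apply: vler_wpM2l; first exact: rcst_ge0.
have h := vmulr_ge0 (idem_ge0 (idem_compl q'q')) (idem_ge0 qq).
by apply: (vle_of_sub h); ring: q'q.
Qed.

Lemma s_lower_le u q r t : q * q = q -> r <= t ->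
  iota (rcst t * q) <= u -> iota (rcst r * q) <= u.
Proof.
move=> qq rt; apply: s_le_down; rewrite !(mulrC _ q); apply: vler_wpM2l.
  exact: idem_ge0.
exact: rcst_le.
Qed.

Lemma s_le_on_sub u q q' r : q' * q' = q' -> q' * q = q' ->
  s_le_on u q r -> s_le_on u q' r.
Proof. by move=> h1 h2 h x /h; exact: le_on_sub. Qed.

Lemma s_le_on_lower u q r t : cell q -> s_le_on u q r -> iota (rcst t * q) <= u ->
  t <= r.
Proof.
move=> hq h /h h'; have [qq _] := hq; apply: (le_on_rcst hq).
by apply: (vge0_eq h'); ring: qq.
Qed.

Lemma s_supp_of_lower u q r : iota 0 <= u -> q * q = q -> 0 < r ->
  iota (rcst r * q) <= u -> q * s_supp u = q.
Proof.
move=> u0 qq r0 h.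
have m0 : 0 < Num.min r 1 by rewrite lt_min r0 ltr01.
apply: (supp_of_lower qq m0); first exact: trunc_ge0 (v1_ge0 F).
have h1 : rcst (Num.min r 1) * q <= trunc u 1.
  apply/le_trunc; split; last by apply: s_lower_le h; rewrite // ge_min lexx.
  apply: le_trans (idem_le1 qq); rewrite -[leRHS]mul1r -(rmorph1 rcst).
  rewrite !(mulrC _ q); apply: vler_wpM2l; first exact: idem_ge0.
  by apply: rcst_le; rewrite ge_min lexx orbT.
by apply: (vge0_eq (le_on_le qq h1)); ring: qq.
Qed.

Lemma s_supp_lower u q : iota 0 <= u -> q * q = q -> q * s_supp u <> 0 ->
  exists q' r, [/\ cell q', q' * q = q', 0 < r & iota (rcst r * q') <= u].
Proof.
move=> u0 qq h.
have [q' [r [hq' q'q r0 h']]] := supp_lower qq (trunc_ge0 u0 (v1_ge0 F)) h.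
exists q', r; split => //.
apply: (s_lower_of_le_on u0 _ _ h'); first by case: hq'.
by case: (trunc_le u 1).
Qed.

(** The complement of [c] is the support of [r - u /\ r], the part where [u] is
    below [r]. *)
Lemma s_level u r : iota 0 <= u -> 0 <= r -> exists c,
  [/\ c * c = c, iota (rcst r * c) <= u & s_le_on u (1 - c) r].
Proof.
move=> u0 r0; have rF := rcst_ge0 F r0; have [t1 t2] := trunc_le u (rcst r).
pose D := supp (rcst r - trunc u (rcst r)); have DD : D * D = D by exact: supp_idem.
have Dt : D * (rcst r - trunc u (rcst r)) = rcst r - trunc u (rcst r).
  by apply: supp_ge0_mul; rewrite vsub_ge0.
have t0 : 0 <= rcst r - trunc u (rcst r) by rewrite vsub_ge0.
exists (1 - D); split; first exact: idem_compl.
  apply: s_le_down t2.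
  have h := vmulr_ge0 (idem_ge0 DD) (trunc_ge0 u0 rF).
  have e : D * trunc u (rcst r) = D * rcst r - rcst r + trunc u (rcst r).
    by move: Dt; rewrite mulrBr => Dt; rewrite -[LHS](subKr (D * rcst r)) Dt; ring.
  by apply: (vle_of_sub h); rewrite e; ring.
move=> x xu; rewrite subKr.
have [//|[p [d [hp pD d0 h]]]] := le_on_or x (rcst r) DD; have [pp _] := hp.
have pne : p * D <> 0 by rewrite pD; case: hp.
have [q [s [hq qp s0 hs]]] := supp_lower pp t0 pne.
exfalso; have [qq _] := hq.
have h1 : iota (rcst r * q) <= u.
  apply: (s_lower_of_le_on u0 qq xu); apply: (le_on_sub qq qp).
  apply: le_on_trans h; apply: le_on_le => //.
  by apply: (vle_of_sub (rcst_ge0 F (ltW d0))); ring.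
have h2 : rcst r * q <= trunc u (rcst r).
  apply/le_trunc; split => //; rewrite -[leRHS]mulr1; apply: vler_wpM2l => //.
  exact: idem_le1.
have : 0 <= - s.
  apply: (cell_rcst hq); rewrite rmorphN.
  apply: (vge0_eq (vaddr_ge0 hs (le_on_le qq h2))); ring: qq.
by rewrite oppr_ge0 leNgt s0.
Qed.

(** ** Band projections, infinite part and finite part *)

Lemma cell_part p q : p * p = p -> q * q = q -> p * q <> 0 ->
  [/\ cell (p * q), p * q * p = p * q & p * q * q = p * q].
Proof.
move=> pp qq pq; split; [split => //; exact: idemM|ring: pp|ring: qq].
Qed.

Lemma le_on_sub_trans q q1 q2 : q2 * q1 = q2 -> q1 * q = q1 -> q2 * q = q2.
Proof. by move=> h1 h2; rewrite -h1 -mulrA h2. Qed.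

Lemma s_le_natmul x u n : (0 < n)%N ->
  iota x <= u *+ n <-> iota (rcst n%:R^-1 * x) <= u.
Proof. by move=> n0; rewrite s_mulrn; apply: s_le_scale; rewrite ltr0n. Qed.

Let natinvK n x : (0 < n)%N -> rcst n%:R^-1 * (rcst n%:R * x) = x.
Proof.
by move=> n0; rewrite mulrA -rmorphM mulVf ?pnatr_eq0 -?lt0n // rmorph1 mul1r.
Qed.

(** Off the support nothing of [y <= n u] survives, since a positive lower bound of
    [y] on a cell would bound [u] below there; on a cell where [u >= t > 0] and
    [x <= c], the meets reach [x] as soon as [n t >= c]. *)
Lemma proj_pos_sup u x : iota 0 <= u -> 0 <= x ->
  supremums [set Order.meet (iota x) (u *+ n) | n in [set n | (0 < n)%N]]
    (iota (x * s_supp u)).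
Proof.
move=> u0 x0; set e := s_supp u; have ee : e * e = e by exact: s_supp_idem.
split => [_ [n /= n0 <-]|b hb].
  rewrite -fin_part_meet iota_le; set y := fin_part _ _.
  have [yx yu] : y <= x /\ iota y <= u *+ n by exact/le_trunc.
  apply: contrapT => /nle_gap [q [r [hq r0 h]]]; have [qq _] := hq.
  have [qe|] := pselect (q * e = 0).
    have h1 : le_on q (rcst r) y by apply: (vge0_eq h); ring: qe.
    move/s_le_natmul : yu => /(_ n0) yu.
    have h2 : le_on q (rcst (n%:R^-1 * r)) (rcst n%:R^-1 * y).
      have i0 : 0 <= n%:R^-1 :> R by rewrite invr_ge0.
      by apply: (vge0_eq (vmulr_ge0 (rcst_ge0 F i0) h1)); rewrite rmorphM; ring.
    have h3 := s_lower_of_le_on u0 qq yu h2.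
    have r'0 : 0 < n%:R^-1 * r by rewrite mulr_gt0 // invr_gt0 ltr0n.
    by case: hq => _; rewrite -(s_supp_of_lower u0 qq r'0 h3).
  move=> /(cell_part qq ee) [hp pq pe]; have [pp _] := hp.
  have : 0 <= - r.
    apply: (cell_rcst hp).
    apply: (vge0_eq (vaddr_ge0 (le_on_sub pp pq h) (le_on_le pp yx))).
    by rewrite rmorphN; ring: ee.
  by rewrite oppr_ge0 leNgt r0.
set z := trunc b x; suff : x * e <= z by move/le_trunc => [].
have zub n y : (0 < n)%N -> y <= x -> iota y <= u *+ n -> y <= z.
  move=> n0 yx yu; apply/le_trunc; split => //.
  apply: le_trans (hb _ _); last by exists n.
  by rewrite lexI iota_le yx yu.
apply: contrapT => /nle_gap [q [r [hq r0 h]]]; have [qq _] := hq.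
have z0 : 0 <= z.
  by apply: (zub 1%N) => //; rewrite mulr1n.
have [qe|] := pselect (q * e = 0).
  have : 0 <= - r.
    apply: (cell_rcst hq); apply: (vge0_eq (vaddr_ge0 h (vmulr_ge0 (idem_ge0 qq) z0))).
    by rewrite rmorphN; ring: qe.
  by rewrite oppr_ge0 leNgt r0.
move=> /(s_supp_lower u0 qq) [q1 [t [hq1 q1q t0 hu]]]; have [q1q1 _] := hq1.
have [q2 [c [hq2 q2q1 c0 hc]]] := le_on_bounded x hq1; have [q2q2 _] := hq2.
pose n := (Num.truncn (c / t)).+1.
have cn : c <= n%:R * t.
  by rewrite -ler_pdivrMr //; apply/ltW; exact: truncnS_gt.
have : x * q2 <= z.
  apply: (zub n) => //.
    by rewrite -[leRHS]mulr1; apply: vler_wpM2l => //; exact: idem_le1.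
  apply/s_le_natmul => //; apply: s_le_down hu.
  have i0 : 0 <= n%:R^-1 :> R by rewrite invr_ge0.
  have h1 := vmulr_ge0 (rcst_ge0 F i0) hc.
  have h2 : 0 <= n%:R^-1 * (n%:R * t - c) by rewrite mulr_ge0 // subr_ge0.
  have h3 := vmulr_ge0 (rcst_ge0 F h2) (idem_ge0 q2q2).
  have h4 := vmulr_ge0 (rcst_ge0 F (ltW t0))
    (vmulr_ge0 (idem_ge0 (idem_compl q2q2)) (idem_ge0 q1q1)).
  apply: (vle_of_sub (vaddr_ge0 (vaddr_ge0 h1 h3) h4)).
  have -> : n%:R^-1 * (n%:R * t - c) = t - n%:R^-1 * c.
    by rewrite mulrBr mulrA mulVf ?pnatr_eq0 // mul1r.
  by rewrite rmorphB rmorphM; ring: q2q1.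
move=> h1; have q2q := le_on_sub_trans q2q1 q1q.
have q1e := s_supp_of_lower u0 q1q1 t0 hu; rewrite -/e in q1e.
have q2e := le_on_sub_trans q2q1 q1e.
have : 0 <= - r.
  apply: (cell_rcst hq2).
  apply: (vge0_eq (vaddr_ge0 (le_on_sub q2q2 q2q h) (le_on_le q2q2 h1))).
  by rewrite rmorphN; ring: q2q2 q2e.
by rewrite oppr_ge0 leNgt r0.
Qed.

Lemma proj_sE u x : iota 0 <= u -> proj_s iota u x = x * s_supp u.
Proof.
move=> u0; rewrite /proj_s /proj_pos.
have ne y : [set Order.meet (iota y) (u *+ n) | n in [set n | (0 < n)%N]] !=set0.
  by exists (Order.meet (iota y) (u *+ 1)), 1%N.
rewrite !(s_supremumE (ne _) (proj_pos_sup u0 _)) ?vpos_ge0 ?vneg_ge0 //.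
by rewrite !fin_part_iota -mulrBl -vposE.
Qed.

Lemma band_sE u : iota 0 <= u -> band_s iota u = [set x | x * s_supp u = x].
Proof.
move=> u0; apply/seteqP; split => [_ [x _ <-]|x /= xe] /=.
  by rewrite proj_sE // -mulrA s_supp_idem.
by exists x => //; rewrite proj_sE.
Qed.

Lemma inf_partP u x : iota 0 <= u ->
  iota x <= inf_part u <-> forall n, (0 < n)%N -> iota (rcst n%:R * x) <= u.
Proof.
move=> u0; rewrite /inf_part.
set A := [set _ | _ in _].
have A0 : A !=set0 by exists (Defs.cscale 1%:R^-1 u), 1%N.
have AP y : lbound A (iota y) <-> forall n, (0 < n)%N -> iota (rcst n%:R * y) <= u.
  split => [h n n0|h _ [n /= n0 <-]].
    have : iota y <= Defs.cscale n%:R^-1 u by apply: h; exists n.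
    by move/s_le_scale; rewrite invrK; apply; rewrite invr_gt0 ltr0n.
  by apply/s_le_scale; rewrite ?invrK ?invr_gt0 ?ltr0n //; exact: h.
have [s hs] : exists s, infimums A s.
  apply: (sc_inf hFs A0); exists (iota 0); apply/AP => n _.
  by rewrite mulr0.
rewrite (s_infimumE A0 hs); case: hs => h1 h2; rewrite -AP.
by split => [xs y /h1|/h2//]; exact: le_trans.
Qed.

Lemma inf_part_ge0 u : iota 0 <= u -> iota 0 <= inf_part u.
Proof. by move=> u0; apply/inf_partP => // n _; rewrite mulr0. Qed.

Lemma inf_part_le u x : iota 0 <= u -> iota x <= inf_part u -> iota x <= u.
Proof. by move=> u0 /inf_partP-/(_ u0 1%N erefl); rewrite rmorph1 mul1r. Qed.

(** The infinite part is unchanged by multiples, so all the meets of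
    [proj_pos_sup] coincide. *)
Lemma inf_part_meet u x : iota 0 <= u -> 0 <= x ->
  trunc (inf_part u) x = x * s_supp (inf_part u).
Proof.
move=> u0 x0; have v0 := inf_part_ge0 u0.
have [h1 h2] := proj_pos_sup v0 x0.
apply/eqP; rewrite eq_le; apply/andP; split.
  rewrite -iota_le fin_part_meet; apply: h1.
  by exists 1%N; rewrite ?mulr1n.
apply/le_trunc; split.
  rewrite -[leRHS]mulr1; apply: vler_wpM2l => //; apply: idem_le1.
  exact: s_supp_idem.
apply: h2 => _ [n /= n0 <-].
rewrite -fin_part_meet; set y := fin_part _ _.
have [_ /(s_le_natmul _ _ n0) /inf_partP-/(_ u0) h] : y <= x /\ iota y <= inf_part u *+ n.
  exact/le_trunc.
apply/inf_partP => // m m0.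
have := h (m * n)%N; rewrite muln_gt0 m0 n0 => /(_ erefl).
by rewrite natrM rmorphM -mulrA [rcst n%:R * _]mulrCA natinvK.
Qed.

Lemma s_top_on_supp_inf u q r : iota 0 <= u -> q * q = q -> 0 <= r ->
  q * s_supp (inf_part u) = q -> iota (rcst r * q) <= inf_part u.
Proof.
move=> u0 qq r0 qf.
have /le_trunc [] // : rcst r * q <= trunc (inf_part u) (rcst r * q).
rewrite inf_part_meet //; first by rewrite -mulrA qf.
by apply: vmulr_ge0; [exact: rcst_ge0|exact: idem_ge0].
Qed.

Lemma supp_inf_of_unbounded u q : iota 0 <= u -> q * q = q ->
  (forall n, iota (rcst n%:R * q) <= u) -> q * s_supp (inf_part u) = q.
Proof.
move=> u0 qq h; apply: (@s_supp_of_lower _ _ 1) => //; first exact: inf_part_ge0.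
by apply/inf_partP => // n _; rewrite rmorph1 mul1r.
Qed.

Lemma idem_disj p q : p * p = p -> q * q = q -> p * q = 0 -> Order.meet p q = 0.
Proof.
move=> pp qq pq; apply/eqP; rewrite eq_le lexI !idem_ge0 // !andbT.
set w := Order.meet _ _; have wp : w <= p by exact: leIl.
have wq : w <= q by exact: leIr.
have h1 := le_on_le pp wq; have h2 := le_on_le (idem_compl pp) wp.
by apply: (vle_of_sub (vaddr_ge0 h1 h2)); ring: pp pq.
Qed.

Lemma idem_absorb_prod p (c : nat -> F) n :
  (forall k, (k < n)%N -> p * c k = p) -> p * \prod_(k < n) c k = p.
Proof.
elim: n => [|n IH] h; first by rewrite big_ord0 mulr1.
by rewrite big_ord_recr /= mulrA IH ?h // => k kn; apply: h; rewrite ltnW.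
Qed.

(** Lateral completeness glues the constants [n]: placing the [n]-th one on the part
    of [1 - c n] left uncovered by the [1 - c k] with [k < n] makes them disjoint. *)
Lemma lateral_bound (c : nat -> F) : (forall n, c n * c n = c n) ->
  exists b, 0 <= b /\ forall n p, p * p = p -> p * c n = 0 ->
    (forall k, (k < n)%N -> p * c k = p) -> le_on p (rcst n%:R) b.
Proof.
move=> cc; pose E n := (1 - c n) * \prod_(k < n) c k.
have EE n : E n * E n = E n.
  apply: idemM; first exact: idem_compl.
  by elim/big_ind: _ => // [|x y]; [exact: mulr1|exact: idemM].
have Edisj m n : (m < n)%N -> E m * E n = 0.
  move=> mn; rewrite /E (bigD1 (Ordinal mn)) //=.
  by ring: (cc m).
have [b hb] : exists b, supremums [set rcst n%:R * E n | n in setT] b.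
  apply: laterally_complete; first by exists (rcst 0%:R * E 0%N), 0%N.
    by move=> _ [n _ <-]; apply: vmulr_ge0; [exact: rcst_ge0|exact: idem_ge0].
  move=> _ _ [m _ <-] [n _ <-] ne.
  have mn0 : E m * E n = 0.
    case: (ltngtP m n) => [/Edisj//|/Edisj <-|mn]; first by rewrite mulrC.
    by case: ne; rewrite mn.
  apply: fmul_disj; last exact: rcst_ge0.
  rewrite -[LHS]/(Order.meet _ _) meetC.
  by apply: fmul_disj; [rewrite -[LHS]/(Order.meet _ _) meetC; exact: idem_disj|exact: rcst_ge0].
exists b; split.
  apply: (supremums_le hb); exists 0%N => //.
  by rewrite rmorph0 mul0r.
move=> n p pp pc pk.
have pE : p * E n = p.
  rewrite /E mulrCA (idem_absorb_prod pk) mulrC mulrBr mulr1 pc subr0 //.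
have h : rcst n%:R * E n <= b by apply: (supremums_le hb); exists n.
by apply: (vge0_eq (le_on_le pp h)); ring: pE.
Qed.

Section FinitePart.
Context (u : Fs) (u0 : iota 0 <= u).
Let f := s_supp (inf_part u).
Let ff : f * f = f. Proof. exact: s_supp_idem. Qed.

(** With [1 - c n] the part where [u <= n], these parts cover the complement of [f]:
    a cell on which [u] exceeds every [n] lies in [f]. *)
Lemma finite_part_bounded :
  exists b, forall x, 0 <= x -> iota x <= u -> x * (1 - f) <= b.
Proof.
have /choice [c hc] : forall n, exists c, [/\ c * c = c, iota (rcst n%:R * c) <= u &
    s_le_on u (1 - c) n%:R] by move=> n; apply: s_level.
have [b [b0 hb]] := lateral_bound (fun n => let: And3 h _ _ := hc n in h).
exists b => x x0 xu; apply: contrapT => /nle_gap [q [r [hq r0 h]]].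
have [qq _] := hq.
have [qf|] := pselect (q * (1 - f) = 0).
  have : 0 <= - r.
    apply: (cell_rcst hq).
    apply: (vge0_eq (vaddr_ge0 h (vmulr_ge0 (idem_ge0 qq) b0))).
    have -> : q * (x * (1 - f) - (b + rcst r)) = x * (q * (1 - f)) - q * (b + rcst r).
      by ring.
    by rewrite qf rmorphN; ring.
  by rewrite oppr_ge0 leNgt r0.
move=> /(cell_part qq (idem_compl ff)); set p := q * (1 - f).
move=> [hp pq pf]; have [pp pn0] := hp.
have [n0 hn0] : exists n, p * (1 - c n) != 0.
  apply: contrapT => /forallNP nc; apply: pn0.
  have pc n : p * c n = p.
    have /negP := nc n; rewrite negbK mulrBr mulr1 subr_eq0 => /eqP; exact: esym.
  have : p * f = p.
    apply: supp_inf_of_unbounded => // n; have [cc cu _] := hc n.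
    exact: s_lower_sub cu.
  by move=> e; rewrite -pf mulrBr mulr1 e subrr.
have [n /eqP hn nmin] := ex_minnP (ex_intro (fun n => p * (1 - c n) != 0) _ hn0).
have [cc _ xc] := hc n; have c'c' := idem_compl cc.
have [hp1 p1p p1c] := cell_part pp c'c' hn.
have [p1p1 _] := hp1; set p1 := p * (1 - c n) in hp1 p1p p1c p1p1.
have h1 : le_on p1 (rcst n%:R) b.
  apply: hb => //; first by rewrite /p1; ring: cc.
  move=> k kn.
  have : ~~ (p * (1 - c k) != 0) by apply/negP => /nmin; rewrite leqNgt kn.
  rewrite negbK mulrBr mulr1 subr_eq0 => /eqP pck.
  by rewrite /p1 mulrAC -pck.
have h2 := le_on_sub p1p1 p1c (xc _ xu).
have h3 := le_on_sub p1p1 (le_on_sub_trans p1p pq) h.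
have p1f : p1 * (1 - f) = p1 by rewrite -p1p -mulrA pf.
have : 0 <= - r.
  apply: (cell_rcst hp1); apply: (vge0_eq (vaddr_ge0 h1 (vaddr_ge0 h2 h3))).
  have -> : p1 * (x * (1 - f) - (b + rcst r)) = x * (p1 * (1 - f)) - p1 * (b + rcst r).
    by ring.
  by rewrite p1f rmorphN; ring.
by rewrite oppr_ge0 leNgt r0.
Qed.

Lemma finite_part_sup :
  supremums [set x * (1 - f) | x in [set x | 0 <= x /\ iota x <= u]]
    (finite_part iota u).
Proof.
have [b hb] := finite_part_bounded.
set A := [set _ | _ in _].
have A0 : A !=set0 by exists (0 * (1 - f)), 0.
have [s hs] : exists s, supremums A s.
  by apply: (@vsup_exists _ _ _ b) => // _ [x [x0 xu] <-]; exact: hb.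
suff -> : finite_part iota u = s by [].
rewrite /finite_part.
have -> : [set iota (x - fin_part iota (Order.meet (iota x) (inf_part u)))
             | x in [set x | 0 <= x /\ iota x <= u]] = iota @` A.
  apply/seteqP; split => [_ [x [x0 xu] <-]|_ [_ [x [x0 xu] <-] <-]].
    exists (x * (1 - f)); first by exists x.
    by rewrite -/(trunc _ _) inf_part_meet // mulrBr mulr1.
  exists x => //.
  by rewrite -/(trunc _ _) inf_part_meet // mulrBr mulr1.
rewrite (@s_supremumE _ (iota s)) ?fin_part_iota //.
  by case: A0 => y Ay; exists (iota y), y.
split => [_ [y Ay <-]|y hy]; first by rewrite iota_le; exact: supremums_le hs Ay.
have : s <= trunc y s.
  apply: (supremums_lub hs) => x Ax; apply/le_trunc; split.
    exact: supremums_le hs Ax.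
  by apply: hy; exists x.
by case/le_trunc.
Qed.

Lemma le_finite_part x : 0 <= x -> iota x <= u -> x * (1 - f) <= finite_part iota u.
Proof. by move=> x0 xu; apply: (supremums_le finite_part_sup); exists x. Qed.

Lemma finite_part_ge0 : 0 <= finite_part iota u.
Proof. by have := le_finite_part (lexx 0) u0; rewrite mul0r. Qed.

Lemma finite_part_off : finite_part iota u * f = 0.
Proof.
have f'0 := idem_ge0 (idem_compl ff).
have h : finite_part iota u <= finite_part iota u * (1 - f).
  apply: (supremums_lub finite_part_sup) => _ [x [x0 xu] <-].
  by apply: (vle_of_le (vler_wpM2l f'0 (le_finite_part x0 xu))); ring: ff.
apply/eqP; rewrite eq_le (vmulr_ge0 finite_part_ge0 (idem_ge0 ff)) andbT.
by apply: (vle_of_le h); ring.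
Qed.

Lemma finite_part_le : iota (finite_part iota u) <= u.
Proof.
have : finite_part iota u <= trunc u (finite_part iota u).
  apply: (supremums_lub finite_part_sup) => _ [x [x0 xu] <-].
  apply/le_trunc; split; first exact: le_finite_part.
  apply: s_le_down xu; rewrite -[leRHS]mulr1; apply: vler_wpM2l => //.
  exact: idem_le1 (idem_compl ff).
by case/le_trunc.
Qed.

Lemma s_leD_iota x y v : iota x <= v -> iota (x + y) <= v + iota y.
Proof. by rewrite (sc_D hFs) => h; exact: cone_leD. Qed.

Lemma s_le_iotaD x y v : iota x <= iota y + v <-> iota (x - y) <= v.
Proof.
split => h; last by rewrite -[x](subrK y) addrC [_ + v]addrC addrC; exact: s_leD_iota.
have := cone_leD _ _ (iota (- y)) h.
rewrite -[Defs.cplus _ _]/(iota x + iota (- y)) -[Defs.cplus _ _]/(iota y + v + iota (- y)).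
rewrite -(sc_D hFs) addrAC -(sc_D hFs) subrr (sc_0 hFs) add0r.
by [].
Qed.

(** The finite part lives off [f] and the infinite part on [f], so their sum is
    also their join. *)
Lemma finite_inf_decomp : iota (finite_part iota u) + inf_part u = u.
Proof.
set w := finite_part iota u; have v0 := inf_part_ge0 u0.
apply/eqP; rewrite eq_le; apply/andP; split; apply: s_le_dense => x.
  move/s_le_iotaD => /(s_vpos_le v0); set v := vpos _ => hv.
  have vf : v * f = v.
    rewrite -inf_part_meet //; last exact: vpos_ge0.
    apply/eqP; rewrite eq_le; apply/andP; split; last exact/le_trunc.
    by case: (trunc_le (inf_part u) v).
  have : w <= trunc u (w + v) - v.
    apply: (supremums_lub finite_part_sup) => _ [y [y0 yu] <-].
    apply: vle_addr; apply/le_trunc; split.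
      by apply: vleD => //; exact: le_finite_part.
    have vu : iota v <= u by exact: inf_part_le.
    apply: s_le_down (s_join_le yu vu).
    have h1 := le_on_le (idem_compl ff) (leUl y v).
    have h2 := le_on_le ff (leUr v y).
    apply: (vle_of_sub (vaddr_ge0 h1 h2)).
    by ring: vf.
  move=> /vle_subr/le_trunc[_]; apply: s_le_down.
  by apply: (vle_of_le (le_vpos (x - w))); rewrite -/v; ring.
move=> xu; apply/s_le_iotaD; have xu' := s_vpos_le u0 xu.
have h : vpos x * (1 - f) <= w by apply: le_finite_part => //; exact: vpos_ge0.
have [_] := trunc_le (inf_part u) (vpos x).
rewrite inf_part_meet ?vpos_ge0 // -/f; apply: s_le_down.
by apply: (vle_of_le (vleD (le_vpos x) h)); ring.
Qed.

End FinitePart.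

(** ** Bands *)

Lemma vabs_ge x : x <= vabs x. Proof. exact: leUl. Qed.
Lemma vabs_geN x : - x <= vabs x. Proof. exact: leUr. Qed.

Lemma vabs_le x y : x <= y -> - x <= y -> vabs x <= y.
Proof. by move=> h1 h2; rewrite /vabs leUx h1 h2. Qed.

Lemma vabs_ge0 x : 0 <= vabs x.
Proof.
have h0 : 0 <= 2^-1 :> R by rewrite invr_ge0.
have h : 0 <= vabs x + vabs x.
  by apply: (vle_of_le (vleD (vabs_ge x) (vabs_geN x))); ring.
apply: (vge0_eq (vmulr_ge0 (rcst_ge0 F h0) h)).
have -> : rcst 2^-1 * (vabs x + vabs x) = (rcst 2^-1 * rcst 2) * vabs x by ring.
by rewrite -rmorphM mulVf ?pnatr_eq0 // rmorph1 mul1r.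
Qed.

Lemma vabs_id x : 0 <= x -> vabs x = x.
Proof.
move=> x0; apply/eqP; rewrite eq_le vabs_ge andbT; apply: vabs_le => //.
by apply: (vle_of_sub (vaddr_ge0 x0 x0)); ring.
Qed.

Lemma vabs_mul_idem x p : p * p = p -> vabs (x * p) = vabs x * p.
Proof.
move=> pp; have p0 := idem_ge0 pp; have p1 := idem_ge0 (idem_compl pp).
apply/eqP; rewrite eq_le; apply/andP; split.
  apply: vabs_le; first by apply: (vle_of_le (vler_wpM2l p0 (vabs_ge x))); ring.
  by apply: (vle_of_le (vler_wpM2l p0 (vabs_geN x))); ring.
have h : vabs x <= vabs x * (1 - p) + vabs (x * p).
  apply: vabs_le.
    by apply: (vle_of_le (vleD (vler_wpM2l p1 (vabs_ge x)) (vabs_ge (x * p)))); ring.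
  by apply: (vle_of_le (vleD (vler_wpM2l p1 (vabs_geN x)) (vabs_geN (x * p)))); ring.
by apply: (vle_of_le h); ring.
Qed.

Lemma vabs_eq0 x : vabs x <= 0 -> x = 0.
Proof.
move=> h; apply/eqP; rewrite eq_le (le_trans (vabs_ge x) h) /=.
by apply: (vle_of_le (le_trans (vabs_geN x) h)); ring.
Qed.

(** Multiplication by [p] and by [1 - p] are complementary band projections. *)
Lemma disj_compl_idem p : p * p = p ->
  disj_compl [set x | x * p = x] = [set x | x * (1 - p) = x].
Proof.
move=> pp; have pp' := idem_compl pp; apply/seteqP; split => x /= h.
  have := disj_mul0 (h p pp); rewrite (vabs_id (idem_ge0 pp)) -vabs_mul_idem // => e.
  have xp : x * p = 0 by apply: vabs_eq0; rewrite e.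
  by rewrite mulrBr mulr1 xp subr0.
move=> y yp; rewrite -h -yp !vabs_mul_idem //.
have d : Order.meet (1 - p) p = 0.
  by apply: idem_disj => //; rewrite mulrBl mul1r pp subrr.
have d1 := fmul_disj _ _ _ d (vabs_ge0 x).
rewrite -[vmeet _ _]/(Order.meet _ _) meetC in d1.
have d2 := fmul_disj _ _ _ d1 (vabs_ge0 y).
by rewrite -[vmeet _ _]/(Order.meet _ _) meetC in d2.
Qed.

Lemma band_proj_idem p x : p * p = p -> band_proj [set y | y * p = y] x = x * p.
Proof.
move=> pp; rewrite /band_proj disj_compl_idem //.
case: xgetP => [y _ /= [yp h]|/(_ (x * p)) []] /=.
  have h0 : (x - y) * p = 0 by rewrite -h; ring: pp.
  by rewrite -[RHS](subrK (y * p)) -mulrBl h0 add0r yp.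
by split; [rewrite -mulrA pp|ring: pp].
Qed.

Lemma is_band_idem p : p * p = p -> is_band [set x | x * p = x].
Proof.
move=> pp; have pp' := idem_compl pp; split; first split.
- by rewrite /= mul0r.
- by move=> x y /= hx hy; rewrite mulrDl hx hy.
- by move=> r x /= hx; rewrite !scale_rcst -mulrA hx.
- move=> x y /= yx xp.
  have h := vler_wpM2l (idem_ge0 pp') yx.
  have e : (1 - p) * vabs x = 0 by rewrite mulrC -vabs_mul_idem // mulrBr mulr1 xp subrr vabs_id.
  rewrite e mulrC -vabs_mul_idem // in h; have := vabs_eq0 h.
  by rewrite mulrBr mulr1 => /eqP; rewrite subr_eq0 => /eqP.
move=> A s hA hs /=; have p0 := idem_ge0 pp; have p1 := idem_ge0 pp'.
have h1 : s <= s * p.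
  apply: (supremums_lub hs) => x Ax; rewrite -(hA _ Ax) !(mulrC _ p).
  by apply: vler_wpM2l => //; exact: supremums_le hs Ax.
have h2 : 0 <= s * (1 - p).
  have [[x Ax]|A0] := pselect (exists x, A x).
    have := vler_wpM2l p1 (supremums_le hs Ax); rewrite -(hA _ Ax) => h.
    by apply: (vle_of_le h); ring: pp.
  have h : s <= s + s * (1 - p).
    by apply: (supremums_lub hs) => x Ax; case: A0; exists x.
  by apply: (vle_of_le h); ring.
apply/eqP; rewrite eq_le h1 andbT; by apply: (vle_of_le h2); ring.
Qed.

Lemma mul_s_supp x : 0 <= x -> x * s_supp (iota x) = x.
Proof.
move=> x0; have i0 : iota 0 <= iota x by rewrite iota_le.
have [h _] := proj_pos_sup i0 x0; apply/eqP; rewrite eq_le; apply/andP; split.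
  rewrite -[leRHS]mulr1; apply: vler_wpM2l => //.
  by apply: idem_le1; exact: s_supp_idem.
by rewrite -iota_le; apply: h; exists 1%N => //; rewrite mulr1n meetxx.
Qed.

Lemma iota_mulrn x n : iota x *+ n = iota (rcst n%:R * x).
Proof. by rewrite s_mulrn -iota_scale. Qed.

(** A band that contains [x] contains every [|y| /\ n x], and these exhaust the
    projection of [|y|] by [proj_pos_sup]. *)
Lemma band_gen_supp x : 0 <= x -> band_gen x = [set y | y * s_supp (iota x) = y].
Proof.
move=> x0; set e := s_supp _; have ee : e * e = e by exact: s_supp_idem.
have i0 : iota 0 <= iota x by rewrite iota_le.
apply/seteqP; split => y.
  apply; split; first exact: is_band_idem.
  by move=> _ /= ->; exact: mul_s_supp.
move=> /= ye B [[[B0 BD BZ Bsol] Bsup] xB].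
have Bx : B x by exact: xB.
apply: (Bsol (vabs y * e)).
  by rewrite -vabs_mul_idem // ye (vabs_id (vabs_ge0 y)).
pose A := [set trunc (iota x *+ n) (vabs y) | n in [set n | (0 < n)%N]].
apply: (Bsup A) => [_ [n /= n0 <-]|].
  have n0' : 0 <= rcst n%:R by exact: rcst_ge0.
  apply: (Bsol (n%:R *: x)); last exact: BZ.
  have [_] := trunc_le (iota x *+ n) (vabs y).
  rewrite iota_mulrn iota_le scale_rcst => h.
  have nx0 := vmulr_ge0 n0' x0.
  rewrite (vabs_id nx0) vabs_id //.
  by apply: trunc_ge0; rewrite ?vabs_ge0 // iota_le.
have [h1 h2] := proj_pos_sup i0 (vabs_ge0 y); split => [_ [n n0 <-]|z hz].
  by rewrite -iota_le fin_part_meet; apply: h1; exists n.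
rewrite -iota_le; apply: h2 => _ [n n0 <-].
by rewrite -fin_part_meet iota_le; apply: hz; exists n.
Qed.

Lemma band_inv_unique x y : 0 <= x -> y * s_supp (iota x) = y ->
  x * y = s_supp (iota x) -> band_inv x = y.
Proof.
move=> x0 ye xy; rewrite /band_inv band_gen_supp // band_proj_idem ?mul1r; last first.
  exact: s_supp_idem.
case: xgetP => [z _ /= [ze xz]|/(_ y) []//].
by rewrite -ze -xy mulrA [z * x]mulrC xz mulrC ye.
Qed.

Lemma infty_dE u v : iota 0 <= v ->
  disj_compl (band_s iota u) = band_s iota (inf_part v) ->
  infty_d iota u = inf_part v.
Proof.
move=> v0 e; rewrite /infty_d e band_sE; last exact: inf_part_ge0.
set f := s_supp _; set B := band_sup_completion _ _.
have w0 := inf_part_ge0 v0.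
have BP (y : Fs) : B y -> y <= inf_part v.
  move=> [A [_ hA [_ h]]]; apply: h => _ [x Ax <-].
  have [_] := trunc_le (inf_part v) (vabs x).
  rewrite inf_part_meet ?vabs_ge0 // -/f -vabs_mul_idem; last exact: s_supp_idem.
  by rewrite (hA _ Ax); apply: s_le_down; exact: vabs_ge.
have Bv : B (inf_part v).
  exists [set x | 0 <= x /\ iota x <= inf_part v]; split; first by exists 0.
    move=> x [x0 xv] /=; rewrite -inf_part_meet //.
    apply/eqP; rewrite eq_le; apply/andP; split; last exact/le_trunc.
    by case: (trunc_le (inf_part v) x).
  split => [_ [x [_ xv] <-]//|y hy]; apply: s_le_dense => x /(s_vpos_le w0) xv.
  apply: s_le_down (le_vpos x) _; apply: hy; exists (vpos x) => //.
  by split => //; exact: vpos_ge0.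
case: xgetP => [y _ [/BP h1 h2]|/(_ (inf_part v)) []//].
by apply/eqP; rewrite eq_le h1 h2.
Qed.

(** * Reciprocal elements of the sup-completion *)

(** Pointwise this is [v <= 1 / u], and [super_reciprocal] is [v >= 1 / u], with
    [1 / 0 = +oo] and [1 / +oo = 0]; real bounds on cells stand for the products
    that the sup-completion does not have. *)
Definition sub_reciprocal u v := forall q r t, cell q -> 0 < r -> 0 < t ->
  iota (rcst r * q) <= u -> iota (rcst t * q) <= v -> r * t <= 1.

Definition super_reciprocal u v := forall q r t, cell q -> 0 <= r -> 0 <= t ->
  r * t < 1 -> s_le_on u q r -> iota (rcst t * q) <= v.

Lemma lt_factor_gap r t : 0 <= t -> r * t < 1 -> exists s, r < s /\ s * t < 1.
Proof.
move=> t0 rt.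
have [t00|tp] := leP t 0.
  exists (r + 1); split; first by rewrite ltrDl.
  by rewrite (le_anti (_ : t <= 0 <= t)) ?t00 ?t0 // mulr0.
have rt' : r < t^-1 by rewrite -[t^-1]mul1r ltr_pdivlMr.
have [h1 h2] := midf_lt rt'.
exists ((r + t^-1) / 2); split => //.
by rewrite -ltr_pdivlMr // mul1r.
Qed.

Lemma sub_reciprocalC u v : sub_reciprocal u v -> sub_reciprocal v u.
Proof. by move=> h q r t hq r0 t0 hv hu; rewrite mulrC; exact: (h q). Qed.

(** If [u >= t] failed, [u <= t] on some cell; then [v >= s] there for some [s > r],
    against [v <= r]. *)
Lemma super_reciprocalC u v : iota 0 <= u ->
  super_reciprocal u v -> super_reciprocal v u.
Proof.
move=> u0 h q r t hq r0 t0 rt hv; have [qq _] := hq.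
have [c [cc cu xc]] := s_level u0 t0.
have [qc|] := pselect (q * (1 - c) = 0).
  have qc' : q * c = q.
    by move/eqP: qc; rewrite mulrBr mulr1 subr_eq0 => /eqP.
  exact: s_lower_sub cu.
move=> /(cell_part qq (idem_compl cc)) [hp pq pc]; have [pp _] := hp.
have [s [rs st]] := lt_factor_gap t0 rt; rewrite mulrC in st.
have s0 : 0 <= s by rewrite ltW // (le_lt_trans r0).
have hs : iota (rcst s * (q * (1 - c))) <= v.
  apply: (h _ t s) => //; exact: s_le_on_sub xc.
have := s_le_on_lower hp (s_le_on_sub pp pq hv) hs.
by rewrite leNgt rs.
Qed.

Lemma s_le_on_off_supp u q : iota 0 <= u -> q * q = q -> q * s_supp u = 0 ->
  s_le_on u q 0.
Proof.
move=> u0 qq qe x xu; have [|[p [r [hp pq r0 h]]]] := le_on_or x 0 qq.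
  by rewrite rmorph0.
have [pp pn0] := hp; rewrite add0r in h.
case: pn0; rewrite -(s_supp_of_lower u0 pp r0 (s_lower_of_le_on u0 pp xu h)).
by rewrite -pq -mulrA qe mulr0.
Qed.

Section Reciprocal.
Context (u v : Fs) (u0 : iota 0 <= u) (v0 : iota 0 <= v).
Hypotheses (sub_uv : sub_reciprocal u v) (super_uv : super_reciprocal u v).

(** A positive lower bound of [u] on a cell bounds [v] from above there; where [u]
    vanishes, [super_reciprocal] with [r = 0] puts [v] above every constant. *)
Lemma supp_inf_reciprocal : s_supp (inf_part v) = 1 - s_supp u.
Proof.
set f := s_supp _; set e := s_supp u.
have ff : f * f = f by exact: s_supp_idem.
have ee : e * e = e by exact: s_supp_idem.
have fe : f * e = 0.
  apply: contrapT => /(s_supp_lower u0 ff) [q [r [hq qf r0 hu]]].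
  have [qq _] := hq.
  have r20 : 0 < 2 / r by rewrite divr_gt0.
  have hv := inf_part_le v0 (s_top_on_supp_inf v0 qq (ltW r20) qf).
  have := sub_uv hq r0 r20 hu hv.
  by rewrite mulrCA mulfV ?gt_eqF // mulr1 lern1.
have h : (1 - f) * (1 - e) = 0.
  apply: contrapT => /(cell_part (idem_compl ff) (idem_compl ee)).
  set q := _ * _ => -[hq qf' qe']; have [qq qn0] := hq.
  have qe : q * e = 0 by rewrite -qe'; ring: ee.
  have qf : q * f = q.
    apply: supp_inf_of_unbounded => // n.
    apply: (super_uv hq (lexx 0)); rewrite ?mul0r //.
    exact: s_le_on_off_supp.
  by case: qn0; rewrite -qf -qf'; ring: ff.
by rewrite -[LHS]addr0 -h; ring: fe.
Qed.

(** Every [x] with [0 <= x <= u] satisfies [x (1 - f) <= u_F], where [f] is the support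
    of the infinite part. *)
Lemma s_le_on_finite_part q r : q * q = q -> q * s_supp (inf_part u) = 0 ->
  le_on q (finite_part iota u) (rcst r) -> s_le_on u q r.
Proof.
move=> qq qf h x xu; apply: le_on_trans (le_on_le qq (le_vpos x)) _.
apply: le_on_trans h.
have h1 := le_finite_part u0 (vpos_ge0 x) (s_vpos_le u0 xu).
by apply: (vge0_eq (le_on_le qq h1)); ring: qf.
Qed.

End Reciprocal.

(** Two elements at once, with the error [d] small enough, relative to the bounds of
    both, for the product of the constants to be known up to [r]. *)
Lemma le_on_approx2 q x y (r : R) : cell q -> 0 <= x -> 0 <= y -> 0 < r ->
  exists q' (a b d : R), [/\ cell q', q' * q = q', [/\ 0 <= a, 0 <= b & 0 < d],
    [/\ le_on q' (rcst a) x, le_on q' x (rcst (a + d)),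
        le_on q' (rcst b) y & le_on q' y (rcst (b + d))] &
    (a + 2 * d) * (b + 2 * d) <= a * b + r].
Proof.
move=> hq x0 y0 r0.
have [q1 [c1 [hq1 q1q c10 xc]]] := le_on_bounded x hq; have [q1q1 _] := hq1.
have [q2 [c2 [hq2 q2q1 c20 yc]]] := le_on_bounded y hq1; have [q2q2 _] := hq2.
(* [(a + 2 d) (b + 2 d) - a b = d (2 a + 2 b + 4 d) <= d K] once [d <= 1] *)
pose K := 2 * c1 + 2 * c2 + 4.
have K0 : 0 < K by rewrite /K ltr_wpDl // addr_ge0 // mulr_ge0.
pose d := Num.min 1 (r / K).
have d0 : 0 < d by rewrite lt_min ltr01 divr_gt0.
have d1 : d <= 1 by rewrite ge_min lexx.
have dK : d * K <= r by rewrite -ler_pdivlMr // ge_min lexx orbT.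
have ge0 z q' : q' * q' = q' -> 0 <= z -> le_on q' (rcst 0) z.
  by move=> h; rewrite rmorph0; exact: le_on_le.
have [q3 [a [hq3 q3q2 a0 ax xa]]] := le_on_approx_ge hq2 d0 (ge0 x _ q2q2 x0).
have [q3q3 _] := hq3.
have [q4 [b [hq4 q4q3 b0 b_y yb]]] := le_on_approx_ge hq3 d0 (ge0 y _ q3q3 y0).
have [q4q4 _] := hq4.
have q4q2 := le_on_sub_trans q4q3 q3q2; have q4q1 := le_on_sub_trans q4q2 q2q1.
have ac : a <= c1.
  apply: (le_on_rcst hq4); apply: le_on_trans (le_on_sub q4q4 q4q1 xc).
  exact: le_on_sub ax.
have bc : b <= c2.
  apply: (le_on_rcst hq4); apply: le_on_trans b_y _.
  exact: le_on_sub yc.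
exists q4, a, b, d; split => //; first exact: le_on_sub_trans q1q.
  by split => //; apply: (le_on_sub q4q4 q4q3).
apply: le_trans (_ : _ <= a * b + d * K) _; last by rewrite lerD2l.
have -> : (a + 2 * d) * (b + 2 * d) = a * b + d * (2 * a + 2 * b + 4 * d) by ring.
rewrite lerD2l; apply: ler_wpM2l; first exact: ltW.
by rewrite /K !lerD ?ler_pM2l // -[leRHS]mulr1 ler_pM2l.
Qed.

(** Let [w] and [z] be the two finite parts and [e] the support of [w]. On a cell
    where [w] is close to [a] and [z] to [b], [sub_reciprocal] forces [a b <= 1]; and
    if the cell lies in [e], then [u] and [v] are finite there, so [a b] can be below
    [1] by no fixed amount, by [super_reciprocal]. Thus [w z = e]. *)
Lemma band_inv_reciprocal u v : iota 0 <= u -> iota 0 <= v ->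
  sub_reciprocal u v -> super_reciprocal u v ->
  band_inv (finite_part iota u) = finite_part iota v.
Proof.
move=> u0 v0 sub_uv super_uv.
have fv := supp_inf_reciprocal u0 v0 sub_uv super_uv.
have fu := supp_inf_reciprocal v0 u0 (sub_reciprocalC sub_uv)
  (super_reciprocalC u0 super_uv).
set w := finite_part iota u; set z := finite_part iota v.
have w0 : 0 <= w by exact: finite_part_ge0.
have z0 : 0 <= z by exact: finite_part_ge0.
have wu : iota w <= u by exact: finite_part_le.
have zv : iota z <= v by exact: finite_part_le.
have wf : w * s_supp (inf_part u) = 0 by exact: finite_part_off.
have zf : z * s_supp (inf_part v) = 0 by exact: finite_part_off.
have iw0 : iota 0 <= iota w by rewrite iota_le.
pose e := s_supp (iota w); have ee : e * e = e by exact: s_supp_idem.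
have we : w * e = w by exact: mul_s_supp.
have lower_off x p q (r : R) : q * q = q -> p * p = p -> 0 < r ->
    le_on q (rcst r) x -> x * p = 0 -> q * p = 0.
  move=> qq pp r0 h xp; apply: contrapT => /(cell_part qq pp) [hqp _ _].
  have : 0 <= - r.
    apply: (cell_rcst hqp); rewrite rmorphN.
    by apply: (vge0_eq (vmulr_ge0 (idem_ge0 pp) h)); ring: xp.
  by rewrite oppr_ge0 leNgt r0.
have wz1 : w * z <= 1.
  apply: contrapT => /nle_gap [q [r [hq r0 h]]].
  have r20 : 0 < r / 2 by rewrite divr_gt0.
  have [p [a [b [d [hp pq [a0 b0 d0] [aw wa bz zb] abd]]]]] :=
    le_on_approx2 hq w0 z0 r20; have [pp _] := hp.
  have h1 : 1 + r <= (a + d) * (b + d).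
    apply: (le_on_rcst hp); rewrite rmorphD rmorph1 rmorphM.
    apply: le_on_trans (le_on_sub pp pq h) _.
    apply: le_onM => //; last exact: le_on_le.
    by apply: le_on_le => //; apply: rcst_ge0; rewrite addr_ge0 // ltW.
  have h2 : (a + d) * (b + d) <= (a + 2 * d) * (b + 2 * d).
    by apply: ler_pM; nra.
  have ab : 1 < a * b by lra.
  have a_gt0 : 0 < a by rewrite lt_neqAle a0 andbT; apply/eqP => a_0; move: ab; rewrite -a_0; lra.
  have b_gt0 : 0 < b by rewrite lt_neqAle b0 andbT; apply/eqP => b_0; move: ab; rewrite -b_0; lra.
  have := sub_uv _ _ _ hp a_gt0 b_gt0 (s_lower_of_le_on u0 pp wu aw)
    (s_lower_of_le_on v0 pp zv bz).
  by rewrite leNgt ab.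
have ewz : e <= w * z.
  apply: contrapT => /nle_gap [q [r [hq r0 h]]]; have [qq _] := hq.
  have qe : q * e <> 0.
    move=> qe; have : 0 <= - r.
      apply: (cell_rcst hq); rewrite rmorphN.
      apply: (vge0_eq (vaddr_ge0 h (vmulr_ge0 (idem_ge0 qq) (vmulr_ge0 w0 z0)))).
      by ring: qe.
    by rewrite oppr_ge0 leNgt r0.
  have [q1 [t [hq1 q1q t0 hw]]] := s_supp_lower iw0 qq qe; have [q1q1 _] := hq1.
  have q1fv : q1 * s_supp (inf_part v) = 0.
    have := s_supp_of_lower u0 q1q1 t0 (le_trans hw wu).
    by rewrite fv mulrBr mulr1 => ->; rewrite subrr.
  have tw : le_on q1 (rcst t) w.
    rewrite iota_le in hw.
    by apply: (vge0_eq (le_on_le q1q1 hw)); ring: q1q1.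
  have q1fu := lower_off _ _ _ _ q1q1 (s_supp_idem (inf_part u)) t0 tw wf.
  have r20 : 0 < r / 2 by rewrite divr_gt0.
  have [p [a [b [d [hp pq1 [a0 b0 d0] [aw wa bz zb] abd]]]]] :=
    le_on_approx2 hq1 w0 z0 r20; have [pp _] := hp.
  have pfu : p * s_supp (inf_part u) = 0 by rewrite -pq1 -mulrA q1fu mulr0.
  have pfv : p * s_supp (inf_part v) = 0 by rewrite -pq1 -mulrA q1fv mulr0.
  have h1 : a * b + r <= 1.
    apply: (le_on_rcst hp); rewrite rmorphD rmorphM rmorph1.
    apply: le_on_trans (le_on_le pp (idem_le1 ee)).
    apply: le_on_trans (le_on_sub pp (le_on_sub_trans pq1 q1q) h).
    apply: le_onD; last by rewrite /le_on subrr mulr0.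
    by apply: le_onM => //; apply: le_on_le => //; exact: rcst_ge0.
  have h2 : (a + d) * (b + 2 * d) < 1.
    have : (a + d) * (b + 2 * d) <= (a + 2 * d) * (b + 2 * d) by apply: ler_pM; nra.
    by lra.
  have ad0 : 0 <= a + d by lra.
  have bd0 : 0 <= b + 2 * d by lra.
  have h3 := super_uv _ _ _ hp ad0 bd0 h2 (s_le_on_finite_part u0 pp pfu wa).
  have := s_le_on_lower hp (s_le_on_finite_part v0 pp pfv zb) h3.
  by rewrite lerD2l leNgt ltr_pMl // ltr1n.
have ze : z * e = z.
  have e'e' := idem_compl ee.
  suff h : z * (1 - e) <= 0.
    have h0 := vmulr_ge0 z0 (idem_ge0 e'e').
    have : z * (1 - e) = 0 by apply/eqP; rewrite eq_le h h0.
    by move/eqP; rewrite mulrBr mulr1 subr_eq0 eq_sym => /eqP.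
  apply: contrapT => /nle_gap [q [r [hq r0 h]]]; have [qq _] := hq.
  rewrite add0r in h.
  have /(cell_part qq e'e') [hp pq pe'] : q * (1 - e) <> 0.
    move=> qe; have : 0 <= - r.
      apply: (cell_rcst hq); rewrite rmorphN; apply: (vge0_eq h).
      have -> : q * (z * (1 - e) - rcst r) = z * (q * (1 - e)) - q * rcst r by ring.
      by rewrite qe; ring.
    by rewrite oppr_ge0 leNgt r0.
  set p := q * (1 - e) in hp pq pe'; have [pp pn0] := hp.
  have rz : le_on p (rcst r) z.
    have := le_on_sub pp pq h; rewrite /le_on => h'.
    apply: (vge0_eq h').
    have -> : p * (z * (1 - e) - rcst r) = z * (p * (1 - e)) - p * rcst r by ring.
    by rewrite pe'; ring.
  have pfv := lower_off _ _ _ _ pp (s_supp_idem (inf_part v)) r0 rz zf.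
  have peu : p * s_supp u <> 0.
    by move=> peu; apply: pn0; rewrite -pfv fv mulrBr mulr1 peu subr0.
  have [p1 [t [hp1 p1p t0 hu]]] := s_supp_lower u0 pp peu; have [p1p1 p1n0] := hp1.
  have p1ev := s_supp_of_lower v0 p1p1 r0
    (s_lower_of_le_on v0 p1p1 zv (le_on_sub p1p1 p1p rz)).
  have tp0 : 0 <= rcst t * p1.
    by apply: vmulr_ge0; [exact/rcst_ge0/ltW|exact: idem_ge0].
  have h1 := le_finite_part u0 tp0 hu.
  rewrite fu subKr -mulrA p1ev -/w in h1.
  have p1e := s_supp_of_lower iw0 p1p1 t0 (_ : iota (rcst t * p1) <= iota w).
  rewrite iota_le in p1e; have {}p1e := p1e h1; rewrite -/e in p1e.
  apply: p1n0; rewrite -p1e -p1p -pe'; ring: ee.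
apply: band_inv_unique => //; rewrite -/e.
apply/eqP; rewrite eq_le ewz andbT -[e]mul1r -ze mulrA ![_ * e]mulrC.
by apply: vler_wpM2l => //; exact: idem_ge0.
Qed.

Theorem reciprocal_gen_inv u v : iota 0 <= u -> iota 0 <= v ->
  sub_reciprocal u v -> super_reciprocal u v ->
  [/\ disj_compl (band_s iota u) = band_s iota (inf_part v),
      band_s iota (inf_part u) = disj_compl (band_s iota v),
      band_inv (finite_part iota u) = finite_part iota v &
      gen_inv iota u = v].
Proof.
move=> u0 v0 sub_uv super_uv.
have disj_inf (w z : Fs) : iota 0 <= w -> iota 0 <= z ->
    s_supp (inf_part z) = 1 - s_supp w ->
    disj_compl (band_s iota w) = band_s iota (inf_part z).
  move=> w0 z0 e; rewrite !band_sE //; last exact: inf_part_ge0.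
  by rewrite disj_compl_idem ?e //; exact: s_supp_idem.
have fv := supp_inf_reciprocal u0 v0 sub_uv super_uv.
have fu := supp_inf_reciprocal v0 u0 (sub_reciprocalC sub_uv)
  (super_reciprocalC u0 super_uv).
have inv := band_inv_reciprocal u0 v0 sub_uv super_uv.
split => //; [exact: disj_inf|by rewrite (disj_inf v u)|].
rewrite /gen_inv inv (infty_dE v0); last exact: disj_inf.
exact: finite_inf_decomp.
Qed.

End SupCompletion.

(** * Power series *)

Section PowerSeries.
Context (R : realType) (F : univCompleteType R).
Implicit Types (x y p q : F) (r t : R) (n m k : nat).
Local Notation rcst := (@rcst R F).

(** By the Bernoulli inequality. *)
Lemma expr_unbounded (b C : R) : 1 < b -> exists n, forall m, (n <= m)%N -> C < b ^+ m.
Proof.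
move=> b1; have bern m : 1 + m%:R * (b - 1) <= b ^+ m.
  elim: m => [|m IH]; first by rewrite mul0r addr0 expr0.
  have h : 1 <= b ^+ m by rewrite exprn_ege1 // ltW.
  have h2 : 0 <= (b - 1) * (b ^+ m - 1) by rewrite mulr_ge0 ?subr_ge0 // ltW.
  by rewrite exprS -natr1; nra.
have b10 : 0 < b - 1 by rewrite subr_gt0.
exists (Num.truncn (C / (b - 1))).+1 => m nm.
apply: lt_le_trans (bern m).
have h : C < (Num.truncn (C / (b - 1))).+1%:R * (b - 1).
  by rewrite -ltr_pdivrMr //; exact: truncnS_gt.
have h2 : (Num.truncn (C / (b - 1))).+1%:R * (b - 1) <= m%:R * (b - 1).
  by rewrite ler_pM2r // ler_nat.
lra.
Qed.

Lemma expr_small (b C e : R) : 0 <= b -> b < 1 -> 0 < e ->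
  exists m, C * b ^+ m < e.
Proof.
move=> b0 b1 e0; have [bz|bn] := eqVneq b 0.
  by exists 1%N; rewrite bz mulr0.
have bp : 0 < b by rewrite lt_neqAle eq_sym bn.
have [|n /(_ n (leqnn n))] := @expr_unbounded b^-1 (C / e).
  by rewrite invf_gt1.
rewrite exprVn ltr_pdivrMr // mulrC ltr_pdivlMr ?exprn_gt0 // => h.
by exists n.
Qed.

Lemma rcst_geometric_decreases (b C : R) : 0 <= b -> b < 1 -> 0 <= C ->
  decreases_to0 (fun m => rcst (C * b ^+ m)).
Proof.
move=> b0 b1 C0; split.
  move=> m n mn; apply: rcst_le; apply: ler_wpM2l => //.
  by apply: ler_wiXn2l => //; exact: ltW.
split => [_ [m _ <-]|y hy]; first by apply: rcst_ge0; rewrite mulr_ge0 ?exprn_ge0.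
apply: contrapT => /nle_gap [q [d [hq d0 h]]]; have [qq _] := hq.
have [m hm] := expr_small C b0 b1 d0.
have : d <= C * b ^+ m.
  apply: (le_on_rcst hq); rewrite add0r in h; apply: le_on_trans h _.
  by apply: le_on_le => //; apply: hy; exists m.
by rewrite leNgt hm.
Qed.

(** The partial sums, lowered by the geometric tails, increase and stay below the
    partial sums raised by the tails. *)
Lemma geometric_series (w : nat -> F) (b : R) N : 0 <= b -> b < 1 ->
  (forall m, (N <= m)%N -> - rcst (b ^+ m) <= w m <= rcst (b ^+ m)) ->
  exists s, forall k, (N <= k)%N ->
    - rcst ((1 - b)^-1 * b ^+ k.+1) <= \sum_(0 <= n < k.+1) w n - s
      <= rcst ((1 - b)^-1 * b ^+ k.+1).
Proof.
move=> b0 b1 hw; have b'0 : 0 < 1 - b by rewrite subr_gt0.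
pose c k := rcst ((1 - b)^-1 * b ^+ k.+1); pose S k := \sum_(0 <= n < k.+1) w n.
have c0 k : 0 <= c k.
  by apply: rcst_ge0; rewrite mulr_ge0 ?exprn_ge0 // invr_ge0 ltW.
have cS k : c k - c k.+1 = rcst (b ^+ k.+1).
  rewrite /c -rmorphB -mulrBr (exprS _ k.+1) -{1}[b ^+ k.+1]mul1r -mulrBl mulrA.
  by rewrite mulVf ?gt_eqF // mul1r.
have SS k : S k.+1 = S k + w k.+1 by rewrite /S big_nat_recr.
have mono d k : (N <= k)%N -> S k - c k <= S (k + d)%N - c (k + d)%N /\
    S (k + d)%N + c (k + d)%N <= S k + c k.
  move=> Nk; elim: d => [|d [IH1 IH2]]; first by rewrite addn0.
  have /andP [h1 h2] := hw (k + d).+1 (leq_trans Nk (leq_trans (leq_addr d k) (leqnSn _))).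
  rewrite addnS SS; rewrite -cS in h1 h2; split.
    by apply: (vle_of_le (vleD IH1 h1)); ring.
  by apply: (vle_of_le (vleD IH2 h2)); ring.
have cross j k : (N <= j)%N -> (N <= k)%N -> S j - c j <= S k + c k.
  move=> Nj Nk; have [jk|kj] := leqP j k.
    have [h _] := mono (k - j)%N j Nj; rewrite subnKC // in h.
    apply: le_trans h _; apply: (vle_of_sub (vaddr_ge0 (c0 k) (c0 k))); ring.
  have [_ h] := mono (j - k)%N k Nk; rewrite subnKC 1?ltnW // in h.
  apply: le_trans h; apply: (vle_of_sub (vaddr_ge0 (c0 j) (c0 j))); ring.
have [s hs] : exists s, supremums [set S j - c j | j in [set j | (N <= j)%N]] s.
  apply: (@vsup_exists _ _ _ (S N + c N)); first by exists (S N - c N), N => /=.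
  by move=> _ [j /= Nj <-]; exact: cross.
exists s => k Nk; apply/andP; split.
  have h : s <= S k + c k by apply: (supremums_lub hs) => _ [j /= Nj <-]; exact: cross.
  by apply: (vle_of_le h); rewrite /S /c; ring.
have h : S k - c k <= s by apply: (supremums_le hs); exists k.
by apply: (vle_of_le h); rewrite /S /c; ring.
Qed.

Lemma cre_sum (I : Type) (s : seq I) (f : I -> cplx F) :
  cre (\sum_(i <- s) f i) = \sum_(i <- s) cre (f i).
Proof. exact: (big_morph (@cre F) (fun z w => erefl) erefl). Qed.

Lemma cim_sum (I : Type) (s : seq I) (f : I -> cplx F) :
  cim (\sum_(i <- s) f i) = \sum_(i <- s) cim (f i).
Proof. exact: (big_morph (@cim F) (fun z w => erefl) erefl). Qed.

Lemma modulus_bounds (z : cplx F) x : modulus z <= x ->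
  - x <= cre z <= x /\ - x <= cim z <= x.
Proof.
move=> h; have h1 := le_trans (cre_le_modulus z) h.
have h2 := le_trans (cim_le_modulus z) h.
have hN : modulus (- z) <= x by rewrite modulusN.
have h3 : - cre z <= x := le_trans (cre_le_modulus (- z)) hN.
have h4 : - cim z <= x := le_trans (cim_le_modulus (- z)) hN.
by rewrite h1 h2 !andbT; split; [apply: (vle_of_le h3)|apply: (vle_of_le h4)]; ring.
Qed.

(** The Weierstrass test: the tails of the geometric series bound the error at all
    points of [D] at once. *)
Lemma geometric_unif_order_cvg (a : nat -> cplx F) c (D : set (cplx F)) (b : R) N :
  0 <= b -> b < 1 -> D !=set0 ->
  (forall z m, D z -> (N <= m)%N -> modulus (a m * (z - c) ^+ m) <= rcst (b ^+ m)) ->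
  unif_order_cvg a c D.
Proof.
move=> b0 b1 [z0 Dz0] h.
pose C := (1 - b)^-1 + (1 - b)^-1.
have C0 : 0 <= (1 - b)^-1 by rewrite invr_ge0 subr_ge0 ltW.
have [S hS] : exists S : cplx F -> cplx F, forall z, D z -> forall k, (N <= k)%N ->
    modulus (power_psum a c z k - S z) <= rcst (C * b ^+ k.+1).
  suff /choice [S hS] : forall z, exists s, D z -> forall k, (N <= k)%N ->
    modulus (power_psum a c z k - s) <= rcst (C * b ^+ k.+1) by exists S.
  move=> z; have [Dz|nDz] := pselect (D z); last by exists 0.
  have [|s1 h1] := @geometric_series (fun m => cre (a m * (z - c) ^+ m)) b N b0 b1.
    by move=> m /(h z m Dz)/modulus_bounds[].
  have [|s2 h2] := @geometric_series (fun m => cim (a m * (z - c) ^+ m)) b N b0 b1.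
    by move=> m /(h z m Dz)/modulus_bounds[].
  exists (Cplx s1 s2) => _ k Nk; rewrite /C mulrDl rmorphD.
  have d0 : 0 <= rcst ((1 - b)^-1 * b ^+ k.+1).
    by apply: rcst_ge0; rewrite mulr_ge0 ?exprn_ge0.
  apply: modulus_le => //.
    by rewrite /= cre_sum; exact: h1.
  by rewrite /= cim_sum; exact: h2.
have dec : decreases_to0 (fun m => rcst (C * b ^+ m)).
  by apply: rcst_geometric_decreases => //; rewrite addr_ge0.
have bound z m k : D z -> (maxn N m <= k)%N ->
    modulus (power_psum a c z k - S z) <= rcst (C * b ^+ m).
  rewrite geq_max => Dz /andP[Nk mk]; apply: le_trans (hS z Dz k Nk) _.
  apply: rcst_le; apply: ler_wpM2l; first by rewrite addr_ge0.
  by apply: ler_wiXn2l => //; [exact: ltW|exact: leqW].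
exists S.
  move=> z Dz; exists (fun m => rcst (C * b ^+ m)) => // m.
  by exists (maxn N m) => n; exact: bound.
exists (fun m => rcst (C * b ^+ m)) => // m; exists (maxn N m) => k mk.
have [s hs] : exists s, supremums [set modulus (power_psum a c z k - S z) | z in D] s.
  apply: (@vsup_exists _ _ _ (rcst (C * b ^+ m))).
    by exists (modulus (power_psum a c z0 k - S z0)), z0.
  by move=> _ [z Dz <-]; exact: bound.
by exists s => //; apply: (supremums_lub hs) => _ [z Dz <-]; exact: bound.
Qed.

(** A term is the difference of two consecutive errors. *)
Lemma order_cvg_terms_bounded (a : nat -> cplx F) c z l :
  order_cvg (power_psum a c z) l ->
  exists x N, forall m, (N <= m)%N -> modulus (a m * (z - c) ^+ m) <= x.
Proof.
move=> [p _ /(_ 0%N) [N hN]]; exists (p 0%N + p 0%N), N.+1 => -[//|m] Nm.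
have -> : a m.+1 * (z - c) ^+ m.+1 =
    (power_psum a c z m.+1 - l) + - (power_psum a c z m - l).
  by rewrite /power_psum big_nat_recr //=; ring.
apply: le_trans (modulusD _ _) _; rewrite modulusN.
by apply: vleD; apply: hN => //; exact: leqW.
Qed.

End PowerSeries.

Section Radius.
Context (R : realType) (F : univCompleteType R) (Fs : orderedConeType R).
Context (iota : F -> Fs) (hFs : is_sup_completion iota).
Context (a : nat -> cplx F) (c : cplx F).
Implicit Types (x y p q : F) (u v : Fs) (r t : R) (n m k : nat).
Local Notation rcst := (@rcst R F).

(** If every member of [A] were at most [t] on [q], so would be its meet with [r q],
    and the distributivity axiom [sc_supI] would give [r q <= t q]. *)
Lemma s_sup_lower (A : set F) u q (r t : R) : A !=set0 -> supremums (iota @` A) u ->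
  cell q -> 0 <= t -> t < r -> iota (rcst r * q) <= u ->
  exists x q', [/\ A x, cell q', q' * q = q' & le_on q' (rcst t) x].
Proof.
move=> A0 hA hq t0 tr hu; have [qq _] := hq; apply: contrapT => h.
have key x : A x -> le_on q x (rcst t).
  move=> Ax; have [//|[q' [d [hq' q'q d0 h']]]] := le_on_or x (rcst t) qq.
  case: h; exists x, q'; split => //; apply: le_on_trans h'.
  apply: le_on_le; first by case: hq'.
  by apply: (vle_of_sub (rcst_ge0 F (ltW d0))); ring.
have iA0 : iota @` A !=set0 by case: A0 => x Ax; exists (iota x), x.
have u1 : supremums [set u] u by split => [y ->//|y]; apply.
have := sc_supI hFs iA0 (ex_intro _ u erefl) hA u1 (rcst r * q).
set B := [set _ | _ in iota @` A]; set B' := [set _ | _ in [set u]].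
have B'u : supremums B' (iota (rcst r * q)).
  have <- : Order.meet u (iota (rcst r * q)) = iota (rcst r * q) by apply/eqP; rewrite eq_le leIr lexI hu lexx.
  by split => [_ [_ -> <-]//|y]; apply; exists u.
have B0 : B !=set0.
  by case: iA0 => y Ay; exists (Order.meet y (iota (rcst r * q))), y.
have [s hs] := s_sup_exists hFs B0.
rewrite (s_supremumE B0 hs) (s_supremumE _ B'u); last first.
  by exists (Order.meet u (iota (rcst r * q))), u.
move=> es; have : s <= iota (rcst t * q).
  case: hs => _; apply => _ [_ [x Ax <-] <-].
  rewrite meetC -(fin_part_meet hFs) -/(trunc iota (iota x) _) (iota_le hFs).
  have [h1] := trunc_le hFs (iota x) (rcst r * q); rewrite (iota_le hFs) => h2.
  have h3 := le_on_trans (le_on_le qq h2) (key _ Ax).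
  have h4 := le_on_le (idem_compl qq) h1.
  by apply: (vle_of_sub (vaddr_ge0 h3 h4)); ring: qq.
rewrite es (iota_le hFs) => /(le_on_le qq) h1.
have : r <= t by apply: (le_on_rcst hq); apply: (vge0_eq h1); ring: qq.
by rewrite leNgt tr.
Qed.

Section Limsup.
Context (x : nat -> F) (x0 : forall m, 0 <= x m).

Definition tail_sup n : Fs :=
  supremum (0 : Fs) [set iota (x m) | m in [set m | (n <= m)%N]].

Lemma tail_supP n : supremums (iota @` (x @` [set m | (n <= m)%N])) (tail_sup n).
Proof.
rewrite /tail_sup image_comp.
have A0 : [set iota (x m) | m in [set m | (n <= m)%N]] !=set0.
  by exists (iota (x n)), n => /=.
have [s hs] := s_sup_exists hFs A0.
by rewrite (s_supremumE A0 hs).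
Qed.

Lemma tail_sup_ge0 n : iota 0 <= tail_sup n.
Proof.
have [h _] := tail_supP n; apply: le_trans (h (iota (x n)) _).
  by rewrite (iota_le hFs).
by exists (x n) => //; exists n => /=.
Qed.

Lemma le_limsup_s u : u <= limsup_s iota x <-> forall n, u <= tail_sup n.
Proof.
rewrite /limsup_s; set A := (X in infimum _ X).
have A0 : A !=set0 by exists (tail_sup 0), 0%N.
have [s hs] : exists s, infimums A s.
  by apply: (sc_inf hFs A0); exists (iota 0) => _ [n _ <-]; exact: tail_sup_ge0.
rewrite (s_infimumE A0 hs); case: hs => h1 h2; split.
  by move=> us n; apply: le_trans us _; apply: h1; exists n.
by move=> h; apply: h2 => _ [n _ <-]; exact: h.
Qed.

End Limsup.

Let L := root_limsup iota a.
Let rho := cvg_radius iota a c.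
Let x m : F := nth_root m (modulus (a m)).

Let x0 m : 0 <= x m. Proof. exact: nth_root_ge0. Qed.

Let xX m : (0 < m)%N -> x m ^+ m = modulus (a m).
Proof. by move=> m0; have [] := nth_rootP m0 (modulus_ge0 (a m)). Qed.

Lemma root_limsup_ge0 : iota 0 <= L.
Proof. by apply/(le_limsup_s x0) => n; exact: tail_sup_ge0. Qed.

(** On the disc of radius [t p] the terms of large index [m] are at most [(r t)^m]. *)
Lemma cvg_spectrum_of_tail n p (r t : R) : p * p = p -> 0 <= r -> 0 <= t -> r * t < 1 ->
  (forall m, (n <= m)%N -> le_on p (x m) (rcst r)) ->
  cvg_spectrum a c (rcst t * p).
Proof.
move=> pp r0 t0 rt h; have tp0 : 0 <= rcst t * p.
  by apply: vmulr_ge0; [exact: rcst_ge0|exact: idem_ge0].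
split => //.
apply: (@geometric_unif_order_cvg _ _ _ _ _ (r * t) (maxn n 1)) => //.
- by rewrite mulr_ge0.
- by exists c; rewrite /closed_disc /= subrr modulus_real.
move=> z m zt; rewrite geq_max => /andP[nm m0].
rewrite modulusM modulusX.
have h1 := vexp_le m (modulus_ge0 (z - c)) zt.
apply: le_trans (vler_wpM2l (modulus_ge0 (a m)) h1) _.
have h2 := le_on_exp m pp (le_on_ge0 pp (x0 m)) (h m nm).
rewrite xX // -rmorphXn in h2.
have tm0 : 0 <= t ^+ m by exact: exprn_ge0.
rewrite exprMn -(prednK m0) (idem_exp _ pp) (prednK m0).
have h3 := vmulr_ge0 (rcst_ge0 F tm0) h2.
have h4 : rcst ((r * t) ^+ m) * p <= rcst ((r * t) ^+ m).
  rewrite -[leRHS]mulr1; apply: vler_wpM2l; last exact: idem_le1.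
  by apply: rcst_ge0; rewrite exprn_ge0 // mulr_ge0.
apply: le_trans h4; apply: (vle_of_sub h3).
by rewrite exprMn rmorphM !rmorphXn; ring.
Qed.

Lemma cvg_spectrum0 : cvg_spectrum a c 0.
Proof.
rewrite -(mulr0 (rcst 0)).
apply: (@cvg_spectrum_of_tail 0 0 0 0) => //; rewrite ?mulr0 // => m _.
by rewrite /le_on mul0r.
Qed.

Lemma cvg_radiusP : supremums (iota @` cvg_spectrum a c) rho.
Proof.
have A0 : iota @` cvg_spectrum a c !=set0.
  by exists (iota 0), 0 => //; exact: cvg_spectrum0.
have [s hs] := s_sup_exists hFs A0.
by rewrite /rho /cvg_radius (s_supremumE A0 hs).
Qed.

Lemma le_cvg_radius y : cvg_spectrum a c y -> iota y <= rho.
Proof. by move=> hy; have [h _] := cvg_radiusP; apply: h; exists y. Qed.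

Lemma cvg_radius_ge0 : iota 0 <= rho.
Proof. exact: le_cvg_radius cvg_spectrum0. Qed.

(** It suffices to find, below any cell in [q], a smaller one [p2] with [t p2] in the
    spectrum. If no tail of the roots were at most [s] on a smaller cell, all tail
    suprema, hence [L], would be at least [s > r]. *)
Lemma radius_super_reciprocal : super_reciprocal iota L rho.
Proof.
move=> q r t hq r0 t0 rt hL; have [qq _] := hq.
set y := trunc iota rho (rcst t * q).
have tq0 : 0 <= rcst t * q.
  by apply: vmulr_ge0; [exact: rcst_ge0|exact: idem_ge0].
have y0 : 0 <= y := trunc_ge0 hFs cvg_radius_ge0 tq0.
suff : rcst t * q <= y by move/(le_trunc hFs) => [].
apply: contrapT => /nle_gap [p [d [hp d0 h]]]; have [pp _] := hp.
have [pq|] := pselect (p * q = 0).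
  have : 0 <= - d.
    apply: (cell_rcst hp); rewrite rmorphN.
    by apply: (vge0_eq (vaddr_ge0 h (vmulr_ge0 (idem_ge0 pp) y0))); ring: pq.
  by rewrite oppr_ge0 leNgt d0.
move=> /(cell_part pp qq); set p1 := p * q => -[hp1 p1p p1q]; have [p1p1 _] := hp1.
have [s [rs st]] := lt_factor_gap t0 rt.
have s0 : 0 <= s by rewrite ltW // (le_lt_trans r0).
have [n [p2 [hp2 p2p1 hx]]] : exists n p2, [/\ cell p2, p2 * p1 = p2 &
    forall m, (n <= m)%N -> le_on p2 (x m) (rcst s)].
  apply: contrapT => nex.
  have : iota (rcst s * p1) <= L.
    apply/(le_limsup_s x0) => n.
    have [e [ee eu xe]] := s_level hFs (tail_sup_ge0 x0 n) s0.
    have [p1e|] := pselect (p1 * (1 - e) = 0).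
      have p1e' : p1 * e = p1.
        by move/eqP: p1e; rewrite mulrBr mulr1 subr_eq0 => /eqP.
      exact: (s_lower_sub hFs s0 ee p1p1 p1e').
    move=> /(cell_part p1p1 (idem_compl ee)) [hp2 p2p1 p2e]; have [p2p2 _] := hp2.
    case: nex; exists n, (p1 * (1 - e)); split => // m nm.
    apply: (s_le_on_sub p2p2 p2e xe).
    have [ub _] := tail_supP x n; apply: ub.
    by exists (x m) => //; exists m.
  move=> /(s_le_on_lower hp1 (s_le_on_sub p1p1 p1q hL)).
  by rewrite leNgt rs.
have [p2p2 _] := hp2.
have p2q := le_on_sub_trans p2p1 p1q; have p2p := le_on_sub_trans p2p1 p1p.
have h1 := le_cvg_radius (cvg_spectrum_of_tail p2p2 s0 t0 st hx).
have h2 : rcst t * p2 <= y.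
  apply/(le_trunc hFs); split => //.
  have h2 := vmulr_ge0 (idem_ge0 (idem_compl p2p2)) tq0.
  by apply: (vle_of_sub h2); ring: p2q.
have : 0 <= - d.
  apply: (cell_rcst hp2); rewrite rmorphN.
  apply: (vge0_eq (vaddr_ge0 (le_on_sub p2p2 p2p h) (le_on_le p2p2 h2))).
  by ring: p2q p2p2.
by rewrite oppr_ge0 leNgt d0.
Qed.

(** Shrink [r] and [t] to [r'] and [t'] with [r' t' > 1]. At [c + y], with [y] in the
    spectrum and [y >= t'] on a cell, the terms are eventually at most [C] on a
    smaller cell, while some root of large index [m] is at least [r'] on a still
    smaller one, where the term is at least [(r' t')^m > C]. *)
Lemma radius_sub_reciprocal : sub_reciprocal iota L rho.
Proof.
move=> q r t hq r0 t0 hL hrho; rewrite leNgt; apply/negP => rt.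
have t1 : r^-1 < t by rewrite -[r^-1]mul1r ltr_pdivrMr // mulrC.
have [ht1 ht2] := midf_lt t1; set t' := (r^-1 + t) / 2 in ht1 ht2.
have t'0 : 0 < t' by apply: lt_trans ht1; rewrite invr_gt0.
have r1 : t'^-1 < r by rewrite -[r]invrK ltf_pV2 // posrE invr_gt0.
have [hr1 hr2] := midf_lt r1; set r' := (t'^-1 + r) / 2 in hr1 hr2.
have r'0 : 0 < r' by apply: lt_trans hr1; rewrite invr_gt0.
have rt' : 1 < r' * t' by rewrite -ltr_pdivrMr // mul1r.
have [y [q1 [[y0 [S hS _]] hq1 q1q hy]]] :=
  s_sup_lower (ex_intro _ 0 cvg_spectrum0) cvg_radiusP hq (ltW t'0) ht2 hrho.
have [q1q1 _] := hq1.
have yc : closed_disc c y (c + Cplx y 0).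
  by rewrite /closed_disc /= addrC addKr modulus_real.
have [M [N hM]] := order_cvg_terms_bounded (hS _ yc).
have [q2 [C [hq2 q2q1 C0 MC]]] := le_on_bounded M hq1; have [q2q2 _] := hq2.
have q2q := le_on_sub_trans q2q1 q1q.
have [n0 hn0] := expr_unbounded C rt'.
pose n1 := maxn (maxn N n0) 1.
have hL2 : iota (rcst r * q2) <= tail_sup x n1.
  have [qq _] := hq; apply: (le_limsup_s x0 _).1.
  exact: (s_lower_sub hFs (ltW r0) qq q2q2 q2q hL).
have xn0 : x @` [set m | (n1 <= m)%N] !=set0 by exists (x n1), n1 => /=.
have [_ [q3 [[m /= nm <-] hq3 q3q2 hx]]] :=
  s_sup_lower xn0 (tail_supP x n1) hq2 (ltW r'0) hr2 hL2.
have [q3q3 _] := hq3.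
have [Nm n0m m0] : [/\ (N <= m)%N, (n0 <= m)%N & (0 < m)%N].
  by move: nm; rewrite /n1 !geq_max => /andP[/andP[-> ->] ->].
have := hM m Nm; rewrite [c + _]addrC addrK modulusM modulusX modulus_real // => hm.
have ge0 (e : R) : 0 < e -> le_on q3 0 (rcst e).
  by move=> e0; apply: le_on_ge0 => //; apply: rcst_ge0; exact: ltW.
have h1 := le_on_exp m q3q3 (ge0 _ r'0) hx.
have h2 := le_on_exp m q3q3 (ge0 _ t'0) (le_on_sub q3q3 (le_on_sub_trans q3q2 q2q1) hy).
rewrite xX // in h1.
have : (r' * t') ^+ m <= C.
  apply: (le_on_rcst hq3); apply: le_on_trans (le_on_sub q3q3 q3q2 MC).
  apply: le_on_trans (le_on_le q3q3 hm).
  rewrite exprMn rmorphM !rmorphXn; apply: le_onM => //.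
    by apply: le_on_ge0 => //; exact: modulus_ge0.
  by apply: le_on_ge0 => //; apply: vexp_ge0; apply: rcst_ge0; exact: ltW.
by rewrite leNgt hn0.
Qed.

End Radius.

Theorem theorem5p21 (R : realType) (F : univCompleteType R)
    (Fs : orderedConeType R) (iota : F -> Fs) (hFs : is_sup_completion iota)
    (c : cplx F) (a : nat -> cplx F) :
  let L := root_limsup iota a in
  let rho := cvg_radius iota a c in
  [/\ disj_compl (band_s iota L) = band_s iota (inf_part rho),
      band_s iota (inf_part L) = disj_compl (band_s iota rho),
      band_inv (finite_part iota L) = finite_part iota rho &
      gen_inv iota L = rho].
Proof.
apply: reciprocal_gen_inv => //.
- exact: root_limsup_ge0.
- exact: cvg_radius_ge0.
- exact: radius_sub_reciprocal.
- exact: radius_super_reciprocal.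
Qed.
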